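(* Let $(M,\omega)$ be a closed Kähler manifold of complex dimension $n\ge2$ and let $2\le k\le n$. Let $\chi_0\in\Gamma_{k-1}(M)$ and let $\tau>0$ be a constant such that $\chi_0-\tau\omega\in\Gamma_{k-1}(M)$ and $\omega-\tau\chi_0\in\Gamma_{k-1}(M)$. If $u\in C^2(M)$ satisfies $\chi_u\in\Gamma_{k-1}(M)$, then for every integer $l$ with $2\le l<k$ and every real $p>0$, $$\frac{k-1}{l-1}\int_0^{\frac12}dt\int_M e^{-pu}\sqrt{-1}\,\partial u\wedge\overline\partial u\wedge\chi_{tu}^{k-2}\wedge\omega^{n-k+1}\ \ge\ \tau^{k-l}\int_0^{\frac12}dt\int_M e^{-pu}\sqrt{-1}\,\partial u\wedge\overline\partial u\wedge\chi_{tu}^{l-2}\wedge\omega^{n-l+1}.$$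
   Context: For a real-valued $C^2$ function $v$ on $M$, $\chi_v=\chi_0+\frac{\sqrt{-1}}2\partial\overline\partial v$; so $\chi_{tu}=\chi_0+t\frac{\sqrt{-1}}2\partial\overline\partial u$. For a real $(1,1)$-form $\chi$ define $\sigma_j(\chi)=\binom nj\frac{\chi^j\wedge\omega^{n-j}}{\omega^n}$. $\chi\in\Gamma_j(M)$ means $\sigma_i(\chi)>0$ everywhere on $M$ for all $1\le i\le j$ ($\chi_0$ is a smooth real $(1,1)$-form; for $\chi_u$ with $u\in C^2$ the condition is understood as these pointwise inequalities). *)

(* Defs.v *)
From HB Require Import structures.
From mathcomp Require Import all_boot all_order all_algebra.
From mathcomp Require Import all_classical all_reals all_analysis.
From mathcomp.real_closed Require Import complex.

Set Implicit Arguments.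
Unset Strict Implicit.
Unset Printing Implicit Defensive.

Import Order.TTheory GRing.Theory Num.Theory.
Import numFieldNormedType.Exports.

Local Open Scope classical_set_scope.
Local Open Scope ring_scope.
Local Open Scope complex_scope.

(* MathComp-Analysis has neither manifolds nor differential forms. A form on a
   complex manifold is represented here by its local expressions in the charts
   of an atlas, and operations on forms are computed chart by chart. *)

Section ExteriorAlgebra.
Context {R : realType} {m : nat}.

(* The complexified exterior algebra of the dual of R^m: [a S] is the
   coefficient of dx_(s1) /\ ... /\ dx_(sq), where s1 < ... < sq are the
   elements of S. *)
Definition extalg := {ffun {set 'I_m} -> R[i]}.

Definition escale (c : R[i]) (a : extalg) : extalg := [ffun S => c * a S].

Definition econst (c : R[i]) : extalg := [ffun S => c *+ (S == finset.set0)].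

Definition dx (i : 'I_m) : extalg := [ffun S => (S == [set i]%SET)%:R].

(* The sign of the permutation that sorts the concatenation of the increasing
   enumerations of A and B is (-1) ^+ inversions A B. *)
Definition inversions (A B : {set 'I_m}) : nat :=
  #|[pred p : 'I_m * 'I_m | [&& p.1 \in A, p.2 \in B & (p.2 < p.1)%N]]|.

Definition wedge (a b : extalg) : extalg :=
  [ffun S : {set 'I_m} => \sum_(A : {set 'I_m} | A \subset S)
     (-1) ^+ inversions A (S :\: A) * a A * b (S :\: A)].

Definition wedge_exp (a : extalg) (k : nat) : extalg :=
  iter k (wedge a) (econst 1).

(* A real form of top degree is [density a] times dx_1 /\ ... /\ dx_m. *)
Definition density (a : extalg) : R := complex.Re (a [set: 'I_m]%SET).

End ExteriorAlgebra.
Arguments extalg : clear implicits.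

Section Euclidean.
Context {R : realType} {m : nat}.
Local Notation E := 'rV[R]_m.

Definition dir (i : 'I_m) : E := delta_mx 0 i.

(* f is of class C^k on the open set U *)
Fixpoint Ck (U : set E) (k : nat) (f : E -> R) : Prop :=
  (forall x, U x -> {for x, continuous f}) /\
  (if k is k'.+1 then
     forall i, (forall x, U x -> derivable f x (dir i)) /\
               Ck U k' (fun x => 'D_(dir i) f x)
   else True).

Definition smooth_on (U : set E) (f : E -> R) : Prop := forall k, Ck U k f.

Definition pderiv (i : 'I_m) (f : E -> R[i]) (x : E) : R[i] :=
  'D_(dir i) (fun y => complex.Re (f y)) x +i*
  'D_(dir i) (fun y => complex.Im (f y)) x.

Definition pderiv_form (i : 'I_m) (a : E -> extalg R m) (x : E) : extalg R m :=
  [ffun S => pderiv i (fun y => a y S) x].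

Definition extd (a : E -> extalg R m) (x : E) : extalg R m :=
  \sum_i wedge (dx i) (pderiv_form i a x).

Definition form_of_fun (f : E -> R) (x : E) : extalg R m := econst (f x)%:C.

Definition smooth_form_on (U : set E) (a : E -> extalg R m) : Prop :=
  forall S, smooth_on U (fun x => complex.Re (a x S)) /\
            smooth_on U (fun x => complex.Im (a x S)).

(* The pullback F^* a; [enum S] is increasing. *)
Definition pullback (F : E -> E) (a : E -> extalg R m) (x : E) : extalg R m :=
  \sum_(S : {set 'I_m})
    escale (a (F x) S)
      (\big[wedge/econst 1]_(i <- enum S)
         extd (form_of_fun (fun y => F y 0 i)) x).

(* The integral over R^m, as an iterated integral. It is only applied to
   continuous functions with compact support. *)
Fixpoint iter_int (s : seq 'I_m) (f : E -> R) (x : E) : R :=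
  if s is i :: s' then
    \int[lebesgue_measure]_r iter_int s' f (x + r *: dir i)
  else f x.

Definition euclid_int (f : E -> R) : R := iter_int (enum 'I_m) f 0.

End Euclidean.

Section ComplexCoordinates.
Context {R : realType} {n : nat}.
(* C^n is R^(2n) with the real coordinates in the order x_1, y_1, x_2, y_2, ...;
   thus dx_1 /\ dy_1 /\ ... /\ dx_n /\ dy_n is positively oriented. *)
Local Notation E := 'rV[R]_(n * 2).
Local Notation Lambda := (extalg R (n * 2)).

Lemma xi_subproof (j : 'I_n) : (j * 2 < n * 2)%N.
Proof. by rewrite ltn_pmul2r. Qed.

Lemma yi_subproof (j : 'I_n) : ((j * 2).+1 < n * 2)%N.
Proof. by rewrite -[_.+2]/(2 + j * 2)%N -mulSn leq_pmul2r. Qed.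

Definition xi (j : 'I_n) : 'I_(n * 2) := Ordinal (xi_subproof j).
Definition yi (j : 'I_n) : 'I_(n * 2) := Ordinal (yi_subproof j).

Definition zcoord (j : 'I_n) (x : E) : R[i] := x 0 (xi j) +i* x 0 (yi j).

Definition dz (j : 'I_n) : Lambda := dx (xi j) + escale 'i (dx (yi j)).
Definition dzbar (j : 'I_n) : Lambda := dx (xi j) - escale 'i (dx (yi j)).

(* Wirtinger derivatives *)
Definition pderiv_z (j : 'I_n) (f : E -> R[i]) (x : E) : R[i] :=
  (pderiv (xi j) f x - 'i * pderiv (yi j) f x) / 2%:R.
Definition pderiv_zbar (j : 'I_n) (f : E -> R[i]) (x : E) : R[i] :=
  (pderiv (xi j) f x + 'i * pderiv (yi j) f x) / 2%:R.

Definition del (a : E -> Lambda) (x : E) : Lambda :=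
  \sum_j wedge (dz j) [ffun S => pderiv_z j (fun y => a y S) x].
Definition delbar (a : E -> Lambda) (x : E) : Lambda :=
  \sum_j wedge (dzbar j) [ffun S => pderiv_zbar j (fun y => a y S) x].

Definition holomorphic_on (U : set E) (F : E -> E) : Prop :=
  (forall i, Ck U 1 (fun x => F x 0 i)) /\
  (forall x, U x -> forall j l, pderiv_zbar j (fun y => zcoord l (F y)) x = 0).

(* (i / 2) \sum_(j, l) h_(j, l) dz_j /\ dzbar_l *)
Definition form11 (h : 'M[R[i]]_n) : Lambda :=
  escale ('i / 2%:R) (\sum_j \sum_l escale (h j l) (wedge (dz j) (dzbar l))).

Definition real11 (a : Lambda) : Prop :=
  (exists h, a = form11 h) /\ (forall S, complex.Im (a S) = 0).

(* In R[i], [0 < c] means that c is real and positive; in particular g is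
   Hermitian. *)
Definition positive11 (a : Lambda) : Prop :=
  exists2 g : 'M[R[i]]_n, a = form11 g &
    forall v : 'I_n -> R[i], (exists j, v j != 0) ->
      0 < \sum_j \sum_l v j * g j l * (v l)^*.

End ComplexCoordinates.

(* A holomorphic atlas on M: the chart i is the homeomorphism [chart_map i] from
   [dom i] onto an open subset of C^n, with inverse [chart_inv i]. *)
Record holAtlas (R : realType) (n : nat) (M : topologicalType) := HolAtlas {
  chart : Type;
  dom : chart -> set M;
  chart_map : chart -> M -> 'rV[R]_(n * 2);
  chart_inv : chart -> 'rV[R]_(n * 2) -> M;
  dom_open : forall i, open (dom i);
  dom_cover : forall p, exists i, dom i p;
  img_open : forall i, open (chart_map i @` dom i);
  chart_mapK : forall i p, dom i p -> chart_inv i (chart_map i p) = p;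
  chart_map_continuous :
    forall i p, dom i p -> {for p, continuous (chart_map i)};
  chart_inv_continuous :
    forall i p, dom i p -> {for chart_map i p, continuous (chart_inv i)};
  transition_holomorphic : forall i j,
    holomorphic_on (chart_map i @` (dom i `&` dom j))
                   (chart_map j \o chart_inv i)
}.

Section Manifold.
Context {R : realType} {n : nat} {M : topologicalType} (A : holAtlas R n M).
Local Notation E := 'rV[R]_(n * 2).
Local Notation Lambda := (extalg R (n * 2)).

Definition img (i : chart A) : set E := chart_map i @` dom i.

Definition funCk (k : nat) (u : M -> R) : Prop :=
  forall i, Ck (img i) k (u \o chart_inv i).

Definition fun_smooth (u : M -> R) : Prop := forall k, funCk k u.

(* [a i] is the local expression of the form a in the chart i; its values
   outside [img i] are irrelevant. *)
Definition local_forms := chart A -> E -> Lambda.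

Definition is_form (a : local_forms) : Prop :=
  forall i j x, (chart_map i @` (dom i `&` dom j)) x ->
    a i x = pullback (chart_map j \o chart_inv i) (a j) x.

Definition smooth_real11_form (a : local_forms) : Prop :=
  [/\ is_form a,
      forall i, smooth_form_on (img i) (a i) &
      forall i x, img i x -> real11 (a i x)].

Definition kahler_form (w : local_forms) : Prop :=
  [/\ smooth_real11_form w,
      forall i x, img i x -> positive11 (w i x) &
      forall i x, img i x -> extd (w i) x = 0].

Definition fun_form (u : M -> R) : local_forms :=
  fun i => form_of_fun (u \o chart_inv i).

(* chi_v = chi0 + (i / 2) del delbar v *)
Definition chi_ (chi0 : local_forms) (v : M -> R) : local_forms :=
  fun i x => chi0 i x + escale ('i / 2%:R) (del (delbar (fun_form v i)) x).

Definition sigma (w : local_forms) (j : nat) (chi : local_forms)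
    (i : chart A) (x : E) : R :=
  'C(n, j)%:R *
  (density (wedge (wedge_exp (chi i x) j) (wedge_exp (w i x) (n - j))) /
   density (wedge_exp (w i x) n)).

Definition Gamma (w : local_forms) (j : nat) (chi : local_forms) : Prop :=
  forall s, (1 <= s <= j)%N -> forall i x, img i x -> 0 < sigma w s chi i x.

(* A finite smooth partition of unity on M subordinate to the charts; the
   function q.2 is supported in the chart q.1. *)
Definition is_partition_of_unity (P : seq (chart A * (M -> R))) : Prop :=
  all (fun q => `[< [/\ fun_smooth q.2, forall p, 0 <= q.2 p &
        closure [set p | q.2 p != 0] `<=` dom q.1] >]) P /\
  forall p, \sum_(q <- P) q.2 p = 1.

(* One exists whenever M is compact and Hausdorff. *)
Definition partition_of_unity : seq (chart A * (M -> R)) :=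
  if pselect (exists P, is_partition_of_unity P) is left e
  then projT1 (cid e) else [::].

(* The integral over M of a continuous real form of degree 2n; it does not
   depend on the partition of unity. *)
Definition manifold_int (a : local_forms) : R :=
  \sum_(q <- partition_of_unity)
    euclid_int
      ((fun x => q.2 (chart_inv q.1 x) * density (a q.1 x)) \_ (img q.1)).

(* e^(-pu) i del u /\ delbar u /\ chi^a /\ w^b *)
Definition weighted_gradient_form (p : R) (u : M -> R) (chi : local_forms)
    (a : nat) (w : local_forms) (b : nat) : local_forms :=
  fun i x =>
    escale ((expR (- p * u (chart_inv i x)))%:C * 'i)
      (wedge (wedge (wedge (del (fun_form u i) x) (delbar (fun_form u i) x))
                    (wedge_exp (chi i x) a))
             (wedge_exp (w i x) b)).

End Manifold.

(* Main.v *)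
(* Write X_t = chi_(tu), V = i del u /\ delbar u, B = chi0 - tau w, and let
   I_N be the integral over t in [0, 1/2] and over M of
   e^(-pu) V X_t^N w^(n-N-1). Since t d/dt X_t = X_t - chi0,
     d/dt (t X_t^(N+1)) = (N+2) X_t^(N+1) - (N+1) tau X_t^N w - (N+1) X_t^N B.
   Multiplying by e^(-pu) V w^(n-N-2) and integrating, (N+2) I_(N+1) - tau (N+1) I_N
   is the sum of the boundary term at t = 1/2 and of the integral of
   (N+1) V X_t^N B w^(n-N-2). Both are nonnegative for N + 2 < k, because X_t and
   B lie in the Garding cone Gamma_(k-1), which is convex, and V is nonnegative.
   Chaining these inequalities for N = l-2, ..., k-3 gives the result.

   The mixed positivity is Garding's inequality for det, viewed as the top
   coefficient of the n-th power of a (1,1)-form in the commutative ring of even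
   forms. *)

From HB Require Import structures.
Require Import Defs.
From mathcomp Require Import all_boot all_order fingroup perm all_algebra.
From mathcomp Require Import all_classical all_reals all_analysis.
From mathcomp.real_closed Require Import complex.
From mathcomp Require Import ring lra.

Set Implicit Arguments.
Unset Strict Implicit.
Unset Printing Implicit Defensive.

Import Order.TTheory GRing.Theory Num.Theory.
Import numFieldNormedType.Exports.

Local Open Scope ring_scope.
Local Open Scope complex_scope.

(** The weight and V do not depend on t, so the integral over M of e^(-pu) V X_t^N w^(n-N-1) is a
    polynomial in t whose coefficients are mixed integrals in chi0 and the Hessian of u. Calculus in
    t is thereby calculus of real polynomials, with no differentiation under the integral sign and
    no integration by parts on M; what is needed from integration over M is linearity and
    positivity. The obstacle is pointwise. For k - 1 < n the cone contains indefinite forms, and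
    several forms cannot be diagonalised at once, so the sign of a mixed product is not visible term
    by term. Garding's argument uses only where the roots of T -> d((a + T e)^m) lie: Gauss-Lucas
    lowers the degree m, and a deformation of the roots changes the direction e. V has rank at most
    one and is only on the boundary of the positive cone, so it is perturbed by a multiple of w,
    which is why the mixed positivity is not strict. *)

Local Notation Re := (@complex.Re _).
Local Notation Im := (@complex.Im _).

(** * The exterior algebra as an associative ring; forms of even degree commute *)

Section ExteriorRing.
Context {R : realType} {m : nat}.
Local Notation C := R[i].
Local Notation L := (extalg R m).
Implicit Types (A B D S : {set 'I_m}) (a b c : L).

Lemma inversionsE A B :
  inversions A B = (\sum_(p in A) \sum_(q in B) (q < p))%N.
Proof.
rewrite /inversions -sum1_card pair_big_dep /= [RHS]big_mkcond [LHS]big_mkcond /=.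
apply: eq_bigr => -[p q] _; rewrite unfold_in /=.
by case: (p \in A); case: (q \in B) => //=; case: (q < p)%N.
Qed.

Lemma sum_setU (F : 'I_m -> nat) A B : [disjoint A & B] ->
  (\sum_(i in A :|: B) F i = \sum_(i in A) F i + \sum_(i in B) F i)%N.
Proof.
move=> AB; rewrite -bigU//; apply: eq_bigl => i; by rewrite !inE.
Qed.

Lemma inversionsUl A B D : [disjoint A & B] ->
  inversions (A :|: B) D = (inversions A D + inversions B D)%N.
Proof. by move=> AB; rewrite !inversionsE sum_setU. Qed.

Lemma inversionsUr A B D : [disjoint B & D] ->
  inversions A (B :|: D) = (inversions A B + inversions A D)%N.
Proof.
move=> BD; rewrite !inversionsE -big_split; apply: eq_bigr => p _.
by rewrite /= sum_setU.
Qed.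

(** Every pair with one index in each set is an inversion in exactly one of the two orders. *)
Lemma inversionsC A B : [disjoint A & B] ->
  (inversions A B + inversions B A = #|A| * #|B|)%N.
Proof.
move=> AB; rewrite !inversionsE [X in (_ + X)%N]exchange_big -big_split /=.
rewrite -sum_nat_const; apply: eq_bigr => p pA.
rewrite -big_split -sum1_card /=; apply: eq_bigr => q qB.
have : p != q by apply: contraTneq qB => <-; rewrite (disjointFr AB).
by rewrite -val_eqE neq_ltn => /orP[] pq; rewrite pq ltnNge ltnW.
Qed.

Lemma wedgeE a b S :
  wedge a b S = \sum_(A : {set 'I_m} | A \subset S)
    (-1) ^+ inversions A (S :\: A) * a A * b (S :\: A).
Proof. by rewrite ffunE. Qed.

(** Both sides are sums over the ordered partitions of S into three blocks. The signs agree because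
    [inversions] is additive over disjoint unions in each argument. *)
Lemma wedgeA a b c : wedge a (wedge b c) = wedge (wedge a b) c.
Proof.
apply/ffunP => S; rewrite !wedgeE.
transitivity (\sum_(A : {set 'I_m} | A \subset S) \sum_(D : {set 'I_m} | D \subset S :\: A)
    (-1) ^+ (inversions A (S :\: A) + inversions D ((S :\: A) :\: D)) *
    a A * b D * c ((S :\: A) :\: D)).
  apply: eq_bigr => A AS; rewrite wedgeE mulr_sumr; apply: eq_bigr => D DS.
  by rewrite exprD !mulrA; congr (_ * _); ring.
transitivity (\sum_(B : {set 'I_m} | B \subset S) \sum_(A : {set 'I_m} | A \subset B)
    (-1) ^+ (inversions B (S :\: B) + inversions A (B :\: A)) *
    a A * b (B :\: A) * c (S :\: B)); last first.
  apply: eq_bigr => B BS; rewrite wedgeE mulr_sumr mulr_suml; apply: eq_bigr => A AB.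
  by rewrite exprD; ring.
rewrite [RHS](exchange_big_dep (fun A : {set 'I_m} => A \subset S)) /=; last first.
  by move=> B A BS AB; apply: fintype.subset_trans AB BS.
apply: eq_bigr => A AS.
rewrite [RHS](reindex_onto (fun D => A :|: D) (fun B => B :\: A)) /=; last first.
  move=> B /andP[BS AB]; apply/setP => x; rewrite !inE.
  by have := fintype.subsetP AB x; case: (x \in A) => //= /(_ isT) ->.
have E D : (A :|: D \subset S) && (A \subset A :|: D) && ((A :|: D) :\: A == D) =
   (D \subset S :\: A).
  rewrite finset.subsetUl andbT finset.subUset AS /= finset.subsetD.
  case: (D \subset S) => //=; apply/eqP/idP => [<-|].
    by rewrite disjoint_sym finset.disjoints_subset finset.setCD finset.subsetUr.
  move=> dDA; apply/setP => x; rewrite !inE.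
  by case xA : (x \in A) => //=; rewrite (disjointFl dDA xA).
rewrite (eq_bigl _ _ E); apply: eq_bigr => D; rewrite finset.subsetD => /andP[DS dDA].
have -> : (A :|: D) :\: A = D.
  apply/setP => x; rewrite !inE.
  by case xA : (x \in A) => //=; rewrite (disjointFl dDA xA).
rewrite finset.setDDl; congr (_ ^+ _ * _ * _ * _).
set F := S :\: (A :|: D).
have dDF : [disjoint D & F].
  by rewrite disjoint_sym finset.disjoints_subset /F finset.setDE finset.subIset// finset.setCU finset.subsetIr orbT.
have EF : S :\: A = D :|: F.
  apply/setP => x; rewrite !inE.
  case xA : (x \in A) => //=; first by rewrite (disjointFl dDA xA).
  case xD : (x \in D) => //=; by rewrite (fintype.subsetP DS).
rewrite EF inversionsUr// inversionsUl 1?disjoint_sym//; ring.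
Qed.

Lemma wedgeDl a b c : wedge (a + b) c = wedge a c + wedge b c.
Proof.
apply/ffunP => S; rewrite !ffunE -big_split; apply: eq_bigr => A _ /=.
by rewrite ffunE; ring.
Qed.

Lemma wedgeDr a b c : wedge c (a + b) = wedge c a + wedge c b.
Proof.
apply/ffunP => S; rewrite !ffunE -big_split; apply: eq_bigr => A _ /=.
by rewrite ffunE; ring.
Qed.

Lemma wedge_const z a : wedge (econst z) a = escale z a.
Proof.
apply/ffunP => S; rewrite !ffunE (bigD1 finset.set0) ?finset.sub0set//= big1 ?addr0.
  rewrite ffunE eqxx finset.setD0.
  suff -> : inversions finset.set0 S = 0%N by rewrite expr0 mul1r.
  by rewrite inversionsE big_set0.
by move=> A /andP[_ /negbTE A0]; rewrite ffunE A0 mulr0 mul0r.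
Qed.

Lemma wedge_constr z a : wedge a (econst z) = escale z a.
Proof.
apply/ffunP => S; rewrite !ffunE (bigD1 S) ?fintype.subxx//= big1 ?addr0.
  rewrite ffunE finset.setDv eqxx.
  suff -> : inversions S finset.set0 = 0%N by rewrite expr0 mul1r mulrC.
  by rewrite inversionsE big1// => p _; rewrite big_set0.
move=> A /andP[AS AS']; rewrite ffunE; case: eqP => [E|_]; last by rewrite mulr0.
by move: AS'; rewrite finset.eqEsubset AS /= -finset.setD_eq0 E eqxx.
Qed.

Lemma escale1 a : escale 1 a = a.
Proof. by apply/ffunP => S; rewrite ffunE mul1r. Qed.

Lemma wedge1l : left_id (econst 1) (@wedge R m).
Proof. by move=> a; rewrite wedge_const escale1. Qed.

Lemma wedge1r : right_id (econst 1) (@wedge R m).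
Proof. by move=> a; rewrite wedge_constr escale1. Qed.

Lemma econst1_neq0 : econst 1 != 0 :> L.
Proof.
by apply/eqP => /ffunP/(_ finset.set0); rewrite !ffunE eqxx => /eqP; rewrite oner_eq0.
Qed.

(* Reversing the factors reverses every pair of indices, one from each factor. *)
Lemma wedgeC_parity (s : bool) a b :
  (forall A B, a A * b B != 0 -> odd (#|A| * #|B|) = s) ->
  wedge a b = escale ((-1) ^+ s) (wedge b a).
Proof.
move=> ab; apply/ffunP => S; rewrite !ffunE mulr_sumr.
rewrite [RHS](reindex_onto (fun A => S :\: A) (fun A => S :\: A)) /=; last first.
  by move=> A AS; rewrite finset.setDDr finset.setDv finset.set0U; apply/finset.setIidPr.
apply: eq_big => [A|A AS].
  rewrite finset.subsetDl /=; apply/idP/eqP => [/finset.setIidPr|<-].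
    by rewrite finset.setDDr finset.setDv finset.set0U.
  by rewrite finset.subsetDl.
have -> : S :\: (S :\: A) = A.
  by rewrite finset.setDDr finset.setDv finset.set0U; apply/finset.setIidPr.
have [ab0|ab0] := eqVneq (a A * b (S :\: A)) 0.
  by rewrite -!mulrA ab0 [b _ * _]mulrC ab0 !mulr0.
rewrite -(ab _ _ ab0) signr_odd -inversionsC; last first.
  by rewrite disjoint_sym finset.disjoints_subset finset.setDE finset.subsetIr.
rewrite exprD -!mulrA; congr (_ * _); rewrite !mulrA -exprD addnn -mul2n exprM.
by rewrite sqrrN expr1n expr1n mul1r mulrC.
Qed.

Definition homogeneous (p : nat) a := forall S, a S != 0 -> #|S| = p.

Lemma homogeneousD p a b : homogeneous p a -> homogeneous p b -> homogeneous p (a + b).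
Proof.
move=> ha hb S; rewrite ffunE; have [->|/ha//] := eqVneq (a S) 0.
by rewrite add0r; apply: hb.
Qed.

Lemma homogeneousZ p z a : homogeneous p a -> homogeneous p (escale z a).
Proof. by move=> ha S; rewrite ffunE mulf_eq0 negb_or => /andP[_ /ha]. Qed.

Lemma homogeneous_dx i : homogeneous 1 (dx i : L).
Proof.
move=> S; rewrite ffunE; have [->|_] := eqVneq S; last by rewrite eqxx.
by rewrite finset.cards1.
Qed.

Lemma homogeneousM p q a b : homogeneous p a -> homogeneous q b ->
  homogeneous (p + q) (wedge a b).
Proof.
move=> ha hb S; rewrite ffunE => nz.
have [A AS] : exists2 A : {set 'I_m}, A \subset S & a A * b (S :\: A) != 0.
  apply/exists_inP; apply: contraNT nz => /exists_inPn no.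
  by rewrite big1// => A /no; rewrite negbK -mulrA => /eqP ->; rewrite mulr0.
rewrite mulf_eq0 negb_or => /andP[/ha <- /hb <-].
by rewrite finset.cardsD (finset.setIidPr AS) subnKC// subset_leq_card.
Qed.

(** Boolean, so that the even forms can be made into a subtype. *)
Definition even_form : pred L :=
  fun a => [forall S : {set 'I_m}, odd #|S| ==> (a S == 0)].

Lemma even_formP a : reflect (forall S, odd #|S| -> a S = 0) (even_form a).
Proof.
apply: (iffP forallP) => H S; first by move=> oS; have := H S; rewrite oS => /eqP.
by apply/implyP => /H ->.
Qed.

Lemma even_form_homogeneous a p : ~~ odd p -> homogeneous p a -> even_form a.
Proof.
move=> ev ha; apply/even_formP => S; apply: contraTeq => /ha ->.
exact: ev.
Qed.

Lemma even_form_const z : even_form (econst z).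
Proof.
apply/even_formP => S; rewrite ffunE; case: eqP => // ->.
by rewrite finset.cards0.
Qed.

Lemma even_formB a b : even_form a -> even_form b -> even_form (a - b).
Proof.
by move=> /even_formP ha /even_formP hb; apply/even_formP => S oS; rewrite !ffunE ha// hb// subrr.
Qed.

Lemma even_form_wedge a b : even_form a -> even_form b -> even_form (wedge a b).
Proof.
move=> /even_formP ha /even_formP hb; apply/even_formP => S oS; rewrite ffunE big1// => A AS.
have : odd #|A| || odd #|S :\: A|.
  rewrite finset.cardsD (finset.setIidPr AS) oddB ?subset_leq_card// oS.
  by case: (odd #|A|).
by move=> /orP[/ha ->|/hb ->]; rewrite ?mulr0 ?mul0r.
Qed.

Lemma even_form_wedgeC a b : even_form a -> wedge a b = wedge b a.
Proof.
move=> /even_formP ha; rewrite (@wedgeC_parity false) ?escale1// => A B.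
by rewrite mulf_eq0 negb_or oddM => /andP[+ _]; apply: contraNF => /andP[/ha ->].
Qed.

Lemma one_form_wedgeC a b : homogeneous 1 a -> homogeneous 1 b ->
  wedge a b = - wedge b a.
Proof.
move=> ha hb; rewrite (@wedgeC_parity true).
  by apply/ffunP => S; rewrite !ffunE mulN1r.
by move=> A B; rewrite mulf_eq0 negb_or => /andP[/ha -> /hb ->].
Qed.

(** Since the dx_i are real, coefficientwise conjugation respects the wedge product; its fixed
    points are the real forms. *)
Definition econj a : L := [ffun S => conjc (a S)].

Lemma econjM a b : econj (wedge a b) = wedge (econj a) (econj b).
Proof.
apply/ffunP => S; rewrite !ffunE rmorph_sum; apply: eq_bigr => A _.
by rewrite !rmorphM rmorphXn rmorphN1 !ffunE.
Qed.

Lemma econjZ z a : econj (escale z a) = escale (conjc z) (econj a).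
Proof. by apply/ffunP => S; rewrite !ffunE rmorphM. Qed.

Lemma econjD a b : econj (a + b) = econj a + econj b.
Proof. by apply/ffunP => S; rewrite !ffunE rmorphD. Qed.

Lemma econj_sum I (r : seq I) (P : pred I) (F : I -> L) :
  econj (\sum_(i <- r | P i) F i) = \sum_(i <- r | P i) econj (F i).
Proof.
apply: (big_morph _ econjD); by apply/ffunP => S; rewrite !ffunE rmorph0.
Qed.

Lemma econj_dx i : econj (dx i) = dx i.
Proof. by apply/ffunP => S; rewrite !ffunE rmorph_nat. Qed.

Lemma escaleD z a b : escale z (a + b) = escale z a + escale z b.
Proof. by apply/ffunP => S; rewrite !ffunE mulrDr. Qed.

Lemma escaleN z a : escale (- z) a = - escale z a.
Proof. by apply/ffunP => S; rewrite !ffunE mulNr. Qed.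

Lemma escaleA z y a : escale z (escale y a) = escale (z * y) a.
Proof. by apply/ffunP => S; rewrite !ffunE mulrA. Qed.

Lemma escale0 z : escale z (0 : L) = 0.
Proof. by apply/ffunP => S; rewrite !ffunE mulr0. Qed.

Lemma escale0l a : escale 0 a = 0.
Proof. by apply/ffunP => S; rewrite !ffunE mul0r. Qed.

Lemma escale_sum z I (r : seq I) (P : pred I) (F : I -> L) :
  escale z (\sum_(i <- r | P i) F i) = \sum_(i <- r | P i) escale z (F i).
Proof. by apply: (big_morph _ (escaleD z)); exact: escale0. Qed.

Lemma wedgeZl z a b : wedge (escale z a) b = escale z (wedge a b).
Proof. by rewrite -wedge_const -wedgeA wedge_const. Qed.

Lemma wedgeZr z a b : wedge a (escale z b) = escale z (wedge a b).
Proof. by rewrite -wedge_constr wedgeA wedge_constr. Qed.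

Lemma wedge0l a : wedge 0 a = 0.
Proof. by rewrite -{1}(escale0l 0) wedgeZl escale0l. Qed.

Lemma wedge0r a : wedge a 0 = 0.
Proof. by rewrite -{1}(escale0l 0) wedgeZr escale0l. Qed.

Lemma wedge_suml b I (r : seq I) (P : pred I) (F : I -> L) :
  wedge (\sum_(i <- r | P i) F i) b = \sum_(i <- r | P i) wedge (F i) b.
Proof. by apply: (big_morph (wedge^~ b)) => [x y|]; [exact: wedgeDl|exact: wedge0l]. Qed.

Lemma wedge_sumr b I (r : seq I) (P : pred I) (F : I -> L) :
  wedge b (\sum_(i <- r | P i) F i) = \sum_(i <- r | P i) wedge b (F i).
Proof. by apply: (big_morph (wedge b)) => [x y|]; [exact: wedgeDr|exact: wedge0r]. Qed.

(** Exchanging the second and fourth of four one-forms is an odd permutation. This is the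
    antisymmetry that later produces a determinant. *)
Lemma one_form_exchange a b c c' : homogeneous 1 a -> homogeneous 1 b ->
  homogeneous 1 c -> homogeneous 1 c' ->
  wedge (wedge a b) (wedge c c') = - wedge (wedge a c') (wedge c b).
Proof.
move=> ha hb hc hc'.
have wN x y : wedge (- x) y = - wedge x y :> L.
  by rewrite -[x in LHS]escale1 -escaleN wedgeZl escaleN escale1.
have Nw x y : wedge x (- y) = - wedge x y :> L.
  by rewrite -[y in LHS]escale1 -escaleN wedgeZr escaleN escale1.
rewrite -!wedgeA (wedgeA b) (one_form_wedgeC hb hc) wN Nw -wedgeA.
by rewrite (one_form_wedgeC hb hc') Nw Nw opprK (wedgeA c) (one_form_wedgeC hc hc') wN Nw -wedgeA.
Qed.

End ExteriorRing.
Arguments homogeneous_dx {R m} i S _.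

Local Open Scope classical_set_scope.
Local Open Scope ring_scope.
Local Open Scope complex_scope.

(** * Location of the roots of a complex polynomial and of its derivative *)

Section ComplexRoots.
Context {R : realType}.
Local Notation C := R[i].
Implicit Types (p : {poly C}) (rs : seq C).

(** Multiplying by X - r with r < 0 only adds up positive multiples of positive coefficients. *)
Lemma coef_prod_neg_roots_gt0 rs : all (fun r => r < 0) rs ->
  forall i, (i <= size rs)%N -> 0 < (\prod_(r <- rs) ('X - r%:P))`_i.
Proof.
elim: rs => [_ i|r rs IH /= /andP[r0 rs0] i].
  by rewrite big_nil leqn0 => /eqP ->; rewrite coef1 ltr01.
have sz : size (\prod_(s <- rs) ('X - s%:P)) = (size rs).+1.
  by rewrite size_prod_XsubC.
rewrite big_cons mulrBl coefB coefXM coefCM => le_i.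
case: i le_i => [|i] /=; first by move=> _; rewrite sub0r -mulNr mulr_gt0 ?oppr_gt0 ?IH.
rewrite ltnS leq_eqVlt => /predU1P[->|lt_i].
  by rewrite [X in _ - r * X]nth_default ?sz// mulr0 subr0 IH.
by rewrite -mulNr addr_gt0 ?mulr_gt0 ?oppr_gt0 ?IH// ltnW.
Qed.

Lemma neg_roots_coef_gt0 p : 0 < lead_coef p -> (forall z, root p z -> z < 0) ->
  forall i, (i < size p)%N -> 0 < p`_i.
Proof.
move=> lp rp i; have [rs Ep] := closed_field_poly_normal p.
have szp : size p = (size rs).+1.
  by rewrite Ep size_scale ?gt_eqF// size_prod_XsubC.
rewrite szp ltnS => le_i; rewrite Ep coefZ mulr_gt0// coef_prod_neg_roots_gt0//.
apply/allP => r rrs; apply: rp; rewrite Ep rootZ ?gt_eqF//.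
by rewrite root_prod_XsubC.
Qed.

Lemma normc_Im_le (z : C) : (Im z)%:C <= `|z|.
Proof.
rewrite normc_def lecR -[leLHS]mulr1 (le_trans (ler_norm _))//.
by rewrite mulr1 -sqrtr_sqr ler_wsqrtr// lerDr sqr_ge0.
Qed.

Lemma ImD (x y : C) : Im (x + y) = Im x + Im y. Proof. by case: x; case: y. Qed.
Lemma ImN (x : C) : Im (- x) = - Im x. Proof. by case: x. Qed.
Lemma ImB (x y : C) : Im (x - y) = Im x - Im y. Proof. by rewrite ImD ImN. Qed.
Lemma ReD (x y : C) : Re (x + y) = Re x + Re y. Proof. by case: x; case: y. Qed.

(** Inversion exchanges the upper and lower half-planes. *)
Lemma Im_mul_inv_lt0 (z : C) : Im z != 0 -> Im z * Im z^-1 < 0.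
Proof.
case: z => a b /= b0; rewrite mulrN oppr_lt0 mulrA divr_gt0//.
  by rewrite -expr2 exprn_even_gt0.
by rewrite ltr_wpDl ?sqr_ge0// exprn_even_gt0.
Qed.

Lemma deriv_prod_XsubC rs (z : C) : (forall r, r \in rs -> z != r) ->
  (\prod_(r <- rs) ('X - r%:P))^`().[z] =
  (\prod_(r <- rs) ('X - r%:P)).[z] * \sum_(r <- rs) (z - r)^-1.
Proof.
elim: rs => [_|r rs IH zrs].
  by rewrite !big_nil mulr0 -polyC1 derivC horner0.
rewrite !big_cons derivM hornerD !hornerM IH; last first.
  by move=> s srs; apply: zrs; rewrite inE srs orbT.
rewrite derivXsubC hornerXsubC hornerC mul1r.
have : z - r != 0 by rewrite subr_eq0 zrs// inE eqxx.
by move=> zr; field.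
Qed.

(* Gauss-Lucas: at a nonreal point the logarithmic derivative of a product of
   real linear factors has nonzero imaginary part. *)
Lemma deriv_real_roots p : (1 < size p)%N ->
  (forall z, root p z -> Im z = 0) -> forall z, root p^`() z -> Im z = 0.
Proof.
move=> sz rp z; have [rs Ep] := closed_field_poly_normal p.
have p0 : lead_coef p != 0 by rewrite lead_coef_eq0 -size_poly_gt0 ltnW.
have rrs r : r \in rs -> Im r = 0.
  by move=> rrs; apply: rp; rewrite Ep rootZ// root_prod_XsubC.
have [//|z0] := eqVneq (Im z) 0.
rewrite {1}Ep derivZ rootZ// /root deriv_prod_XsubC; last first.
  by move=> r /rrs ir; apply: contraNneq z0 => ->; apply/eqP.
rewrite mulf_eq0 => /orP[/eqP E|/eqP E].
  by apply: rrs; rewrite -root_prod_XsubC /root E.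
have: Im z * Im (\sum_(r <- rs) (z - r)^-1) < 0; last by rewrite E mulr0 ltxx.
have: (0 < size rs)%N by move: sz; rewrite Ep size_scale// size_prod_XsubC ltnS.
have I0 s : s \in rs -> Im z * Im (z - s)^-1 < 0.
  move=> /rrs is0; have Ez : Im z = Im (z - s) by rewrite ImB is0 subr0.
  by rewrite {1}Ez; apply: Im_mul_inv_lt0; rewrite -Ez.
case: rs I0 {Ep rrs E} => // r rs I0 _.
rewrite big_cons ImD mulrDr ltr_wnDr// ?I0 ?inE ?eqxx// big_seq.
elim/big_ind : _ => [|x y x0 y0|s srs]; first by rewrite mulr0.
  by rewrite ImD mulrDr; lra.
by rewrite ltW// I0// inE srs orbT.
Qed.

End ComplexRoots.

(** * Motion of the roots in a one-parameter family of polynomials *)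

Section RootPath.
Context {R : realType}.
Local Notation C := R[i].
Implicit Types (q : {poly C}) (Q : {poly {poly C}}).

Lemma horner_locally_close q (s0 : R) (e : C) : 0 < e ->
  \forall s \near s0, `|q.[s%:C] - q.[s0%:C]| < e.
Proof.
move=> e0.
have [h Eh] : exists h, q - (q.[s0%:C])%:P = h * ('X - (s0%:C)%:P).
  by apply/factor_theorem; rewrite rootE !hornerE subrr.
(* [K] bounds the cofactor [h] on the disc of radius [|s0| + 1]; the summand 1 makes it invertible.
   As [e] lives in C, the radius of the neighbourhood in R is the real part of [e / K]. *)
pose K : C := 1 + \sum_(i < size h) `|h`_i| * (`|s0%:C| + 1) ^+ i.
have K0 : 0 < K.
  by rewrite ltr_pwDl// sumr_ge0// => i _.
have eKr : e / K \is Num.real by rewrite ger0_real// divr_ge0// ltW.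
have EeK : e / K = (Re (e / K))%:C by rewrite RRe_real.
have eK0 : 0 < Re (e / K) by rewrite -ltcR -EeK divr_gt0.
near=> s.
have s1 : `|s - s0| < 1 by rewrite distrC; near: s; apply: (@cvgr_dist_lt _ R^o _ _ _ id s0) => //; exact: cvg_id.
have se : `|s - s0| < Re (e / K) by rewrite distrC; near: s; apply: (@cvgr_dist_lt _ R^o _ _ _ id s0) => //; exact: cvg_id.
have normR (x : R) : `|x%:C| = `|x|%:C :> C.
  by rewrite normc_def /= expr0n addr0 sqrtr_sqr.
have -> : q.[s%:C] - q.[s0%:C] = h.[s%:C] * (s%:C - s0%:C).
  by have /(congr1 (fun p => p.[s%:C])) := Eh; rewrite !hornerE.
have le1 : `|s%:C| <= `|s0%:C| + 1 :> C.
  rewrite !normR -[1]/(1%:C) -rmorphD lecR.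
  have -> : s = s0 + (s - s0) by rewrite addrC subrK.
  by rewrite (le_trans (ler_normD _ _))// lerD2l ltW.
have le2 : `|h.[s%:C]| <= K.
  rewrite horner_coef (le_trans (ler_norm_sum _ _ _))// /K ler_wpDl//.
  apply: ler_sum => i _; rewrite normrM normrX ler_wpM2l//.
  by rewrite lerXn2r// ?nnegrE ?addr_ge0.
rewrite normrM -rmorphB normR.
have -> : e = K * (Re (e / K))%:C by rewrite -EeK mulrC divfK ?gt_eqF.
by rewrite (le_lt_trans (ler_wpM2r _ le2)) ?lecR// ltr_pM2l// ltcR.
Unshelve. all: by end_near. Qed.

(** [Q] is a polynomial in two variables: the outer one is z, and the coefficients are polynomials
    in the parameter s, which is evaluated here. *)
Definition specialize_coefs (s : R) Q : {poly C} := map_poly (horner_eval s%:C) Q.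

Lemma specialize_coefsE s Q (z : C) n : (size Q <= n)%N ->
  (specialize_coefs s Q).[z] = \sum_(i < n) (Q`_i).[s%:C] * z ^+ i.
Proof.
move=> sz; rewrite (@horner_coef_wide _ n); last by rewrite (leq_trans (size_poly _ _)).
by apply: eq_bigr => i _; rewrite coef_map.
Qed.

(** The bound is uniform over all z because it is weighted by the growth of the polynomial at
    infinity; this prevents roots from escaping to infinity as s varies. *)
Lemma specialize_locally_close Q (s0 : R) (e : C) : 0 < e ->
  \forall s \near s0, forall z : C,
   `|(specialize_coefs s Q).[z] - (specialize_coefs s0 Q).[z]| <=
     e * (1 + `|z|) ^+ (size Q).-1.
Proof.
move=> e0; set n := size Q.
have n0 : 0 < n.+1%:R :> C by rewrite ltr0n.
have : \forall s \near s0, forall i : 'I_n,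
    `|(Q`_i).[s%:C] - (Q`_i).[s0%:C]| < e / n.+1%:R.
  apply: (@filter_forall R 'I_n _ (nbhs s0)) => i.
  by apply: horner_locally_close; rewrite divr_gt0.
apply: filterS => s sQ z; rewrite !(@specialize_coefsE _ _ _ n)// -sumrB.
rewrite (le_trans (ler_norm_sum _ _ _))//.
have z1 : 1 <= 1 + `|z| by rewrite lerDl.
apply: (@le_trans _ _ (\sum_(i < n) e / n.+1%:R * (1 + `|z|) ^+ n.-1)).
  apply: ler_sum => i _; rewrite -mulrBl normrM normrX; apply: ler_pM => //; first exact/ltW.
  rewrite (@le_trans _ _ ((1 + `|z|) ^+ i))// ?lerXn2r ?nnegrE ?addr_ge0 ?lerDr//.
  by rewrite ler_weXn2l// -ltnS prednK// (leq_trans _ (ltn_ord i)).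
rewrite sumr_const card_ord -mulrnAl -mulr_natr; apply: ler_wpM2r; first by rewrite exprn_ge0// addr_ge0.
by rewrite -mulrA ler_piMr// ?ltW// mulrC ltr_pdivrMr// mul1r ltr_nat.
Qed.

Lemma halfplane_root_distance (r : C) : Im r < 0 ->
  exists2 c : C, 0 < c & forall z, 0 <= Im z -> c * (1 + `|z|) <= `|z - r|.
Proof.
move=> r0; pose y : C := (- Im r)%:C.
have y0 : 0 < y by rewrite -[0]/(0%:C) ltcR oppr_gt0.
have r1 : 0 < 1 + `|r| by rewrite ltr_pwDl.
(* With y = -Im r, the constant comes from combining y <= |z - r| with |z| <= |r| + |z - r|. *)
exists (y / (1 + `|r| + y)) => [|z z0]; first by rewrite divr_gt0// addr_gt0.
rewrite mulrAC ler_pdivrMr ?(addr_gt0 r1)//.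
have le1 : y <= `|z - r|.
  by rewrite (le_trans _ (normc_Im_le _))// lecR ImB lerDr.
have le2 : `|z| <= `|r| + `|z - r|.
  by have := ler_normD r (z - r); rewrite addrC subrK.
rewrite (@le_trans _ _ (y * (1 + `|r| + `|z - r|)))//.
  by rewrite ler_pM2l// -addrA lerD2l.
rewrite mulrDr [leRHS]mulrDr; apply: lerD; last by rewrite mulrC.
by rewrite ler_wpM2r// ltW.
Qed.

(** Each linear factor grows at least like 1 + |z| on the closed upper half-plane, so the product
    has the growth that [specialize_locally_close] has to be compared with. *)
Lemma halfplane_lower_bound (p : {poly C}) : p != 0 -> (forall z, root p z -> Im z < 0) ->
  exists2 c : C, 0 < c &
    forall z, 0 <= Im z -> c * (1 + `|z|) ^+ (size p).-1 <= `|p.[z]|.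
Proof.
move=> p0 rp; have [rs Ep] := closed_field_poly_normal p.
have lp : lead_coef p != 0 by rewrite lead_coef_eq0.
have szp : (size p).-1 = size rs by rewrite Ep size_scale// size_prod_XsubC.
have rrs r : r \in rs -> Im r < 0.
  by move=> rrs; apply: rp; rewrite Ep rootZ// root_prod_XsubC.
suff [c c0 cP] : exists2 c : C, 0 < c & forall z, 0 <= Im z ->
    c * (1 + `|z|) ^+ (size rs) <= `|(\prod_(r <- rs) ('X - r%:P)).[z]|.
  exists (`|lead_coef p| * c) => [|z z0]; first by rewrite mulr_gt0 ?normr_gt0.
  by rewrite szp {2}Ep hornerZ normrM -mulrA ler_wpM2l// cP.
elim: rs rrs {Ep szp} => [_|r rs IH rrs].
  by exists 1 => // z _; rewrite big_nil hornerC normr1 expr0 mulr1.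
have [|c c0 cP] := IH; first by move=> s srs; apply: rrs; rewrite inE srs orbT.
have [|d d0 dP] := @halfplane_root_distance r; first by apply: rrs; rewrite inE eqxx.
exists (d * c) => [|z z0]; first by rewrite mulr_gt0.
rewrite big_cons hornerM hornerXsubC normrM exprS mulrACA ler_pM ?dP ?cP//.
  by rewrite mulr_ge0 ?addr_ge0// ltW.
by rewrite mulr_ge0 ?exprn_ge0 ?addr_ge0// ltW.
Qed.

(* The set of parameters for which some root lies in the upper half-plane and the
   set for which all roots lie in the lower one are both open. *)
Lemma root_path Q (L : C) : L != 0 -> lead_coef Q = L%:P ->
  (forall s z, 0 <= s < 1 -> Im z = 0 -> ~~ root (specialize_coefs s Q) z) ->
  (forall z, root (specialize_coefs 0 Q) z -> Im z < 0) ->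
  forall z, root (specialize_coefs 1 Q) z -> Im z <= 0.
Proof.
move=> L0 LQ noreal at0 z1 rz1; rewrite leNgt; apply/negP => z1_gt0.
have lead s : lead_coef (specialize_coefs s Q) = L.
  by rewrite lead_coef_map_eq LQ /= /horner_eval hornerC.
have F0 s : specialize_coefs s Q != 0 by rewrite -lead_coef_eq0 lead.
have szF s : size (specialize_coefs s Q) = size Q.
  by rewrite size_map_poly_id0//= LQ /horner_eval hornerC.
have up s0 z0 : root (specialize_coefs s0 Q) z0 -> 0 < Im z0 ->
    \forall s \near s0, exists2 z, root (specialize_coefs s Q) z & 0 < Im z.
  move=> rz0 z0_gt0; set n := (size Q).-1.
  have y0 : 0 < (Im z0)%:C :> C by rewrite -[0]/(0%:C) ltcR.
  (* Chosen so that e (1 + |z0|)^n is half of |L| (Im z0)^n. If no root for s had positive imaginary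
     part, every root would be at distance at least Im z0 from z0, and the value at z0 would be at
     least |L| (Im z0)^n, twice what closeness allows. *)
  pose e := `|L| * (Im z0)%:C ^+ n / (1 + `|z0|) ^+ n / 2%:R.
  have zn0 : 0 < (1 + `|z0|) ^+ n by rewrite exprn_gt0// ltr_pwDl.
  have e0 : 0 < e.
    by apply: divr_gt0 => //; apply: divr_gt0 => //; apply: mulr_gt0; rewrite ?normr_gt0 ?exprn_gt0.
  have := specialize_locally_close Q s0 e0; apply: filterS => s /(_ z0).
  rewrite (rootP rz0) subr0 => le1.
  have [//|no] := pselect (exists2 z, root (specialize_coefs s Q) z & 0 < Im z).
  exfalso; have [rs Ep] := closed_field_poly_normal (specialize_coefs s Q).
  have sz : size rs = n by rewrite /n -(szF s) Ep size_scale ?lead// size_prod_XsubC.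
  have rrs r : r \in rs -> Im r <= 0.
    move=> rrs; rewrite leNgt; apply/negP => r0; apply: no; exists r => //.
    by rewrite Ep rootZ ?lead// root_prod_XsubC.
  have le2 : (Im z0)%:C ^+ n <= `|(\prod_(r <- rs) ('X - r%:P)).[z0]|.
    rewrite -sz; elim: rs rrs {Ep sz} => [_|r rs IH rrs].
      by rewrite big_nil hornerC normr1 expr0.
    rewrite big_cons hornerM hornerXsubC normrM exprS; apply: ler_pM.
    - exact: ltW.
    - by rewrite exprn_ge0// ltW.
    - rewrite (le_trans _ (normc_Im_le _))// lecR ImB lerDl oppr_ge0 rrs//.
      by rewrite inE eqxx.
    - by apply: IH => t trs; apply: rrs; rewrite inE trs orbT.
  move: le1; rewrite Ep hornerZ normrM lead /e mulrAC divfK ?gt_eqF// => le1.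
  have : `|L| * (Im z0)%:C ^+ n <= `|L| * (Im z0)%:C ^+ n / 2%:R.
    by rewrite (le_trans _ le1)// ler_wpM2l.
  rewrite ler_pdivlMr// ger_pMr ?mulr_gt0 ?normr_gt0 ?exprn_gt0//.
  by rewrite -[1]/(1%:R) ler_nat.
(* Half of the lower bound [c] is allowed as error, so the perturbed polynomial cannot vanish on the
   closed upper half-plane. *)
have down s0 : (forall z, root (specialize_coefs s0 Q) z -> Im z < 0) ->
    \forall s \near s0, forall z, root (specialize_coefs s Q) z -> Im z < 0.
  move=> neg; have [c c0 cP] := halfplane_lower_bound (F0 s0) neg.
  have c20 : 0 < c / 2%:R by rewrite divr_gt0.
  have := specialize_locally_close Q s0 c20; apply: filterS => s sP z rz.
  rewrite ltNge; apply/negP => z0; have := sP z; rewrite (rootP rz) sub0r normrN.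
  have z1_pos : 0 < (1 + `|z|) ^+ (size Q).-1 by rewrite exprn_gt0// ltr_pwDl.
  move=> /(le_trans (cP z z0)); rewrite szF ler_pM2r// ler_pdivlMr//.
  by rewrite ger_pMr// -[1]/(1%:R) ler_nat.
(* At the supremum, [up] excludes roots in the upper half-plane, since they would persist at nearby
   members of [S]. If the supremum were less than 1, real roots would be excluded by [noreal], and
   [down] would push [S] beyond it. So it is 1, which contradicts the root [z1]. *)
pose S : set R := [set s | 0 <= s <= 1 /\
   forall z, root (specialize_coefs s Q) z -> Im z < 0].
have S0 : S 0 by split=> //; rewrite lexx ler01.
have Sub : ubound S 1 by move=> s [/andP[]].
have supS : has_sup S by split; [exists 0|exists 1].
have s0 : 0 <= sup S by apply: ub_le_sup => //; exists 1.
have s1 : sup S <= 1 by apply: ge_sup => //; exists 0.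
have [[z rz z0]|no] := pselect (exists2 z, root (specialize_coefs (sup S) Q) z & 0 < Im z).
  have /nbhs_ballP[e /= e0 eP] := up _ _ rz z0.
  have [s Ss se] := sup_adherent e0 supS.
  have [|z' rz' z'0] := eP s.
    rewrite /ball /= ger0_norm ?subr_ge0; last by apply: ub_le_sup => //; exists 1.
    by rewrite ltrBlDr -ltrBlDl.
  by have := Ss.2 _ rz'; rewrite ltNge ltW.
have lt1 : sup S < 1.
  rewrite lt_neqAle s1 andbT; apply/eqP => E; apply: no; exists z1 => //.
  by rewrite E.
have neg z : root (specialize_coefs (sup S) Q) z -> Im z < 0.
  move=> rz; rewrite lt_neqAle; apply/andP; split.
    apply/eqP => z0; have := noreal (sup S) z; rewrite s0 lt1 rz => H.
    by have := H isT z0.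
  by rewrite leNgt; apply/negP => z0; apply: no; exists z.
have /nbhs_ballP[e /= e0 eP] := down _ neg.
pose d := Num.min (e / 2) ((1 - sup S) / 2).
have d0 : 0 < d by rewrite lt_min !divr_gt0// subr_gt0.
have : S (sup S + d).
  split; last first.
    apply: eP; rewrite /ball /= opprD addrA subrr sub0r normrN gtr0_norm//.
    by rewrite gt_min ltr_pdivrMr// ltr_pMr// ltr1n.
  have : d <= (1 - sup S) / 2 by rewrite ge_min lexx orbT.
  by move: d0; lra.
move=> /(ub_le_sup (ex_intro _ 1 Sub)); rewrite gerDl; by rewrite leNgt d0.
Qed.

End RootPath.

(** * Garding's inequality for hyperbolic polynomials of the form d (x ^+ m) *)

Section Garding.
Context {R : realType} {K : comNzRingType}.
Local Notation C := R[i].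
Variable io : {rmorphism C -> K}.
Variable W : K -> Prop.
Hypothesis WD : forall x y, W x -> W y -> W (x + y).
Hypothesis WZ : forall (r : R) x, W x -> W (io r%:C * x).
Implicit Types (d : K -> C) (a b c e v : K).

Definition linear_form d :=
  (forall x y, d (x + y) = d x + d y) /\ (forall z x, d (io z * x) = z * d x).

(* Garding hyperbolicity in the direction e of the homogeneous polynomial
   x |-> d (x ^+ m) on the real space W. *)
Definition hyperbolic (m : nat) e d :=
  0 < d (e ^+ m) /\ forall a T, W a -> d ((a + io T * e) ^+ m) = 0 -> Im T = 0.

(** Up to binomial factors these are the coefficients of T -> d((a + T e)^m). When its roots are
    real, all coefficients are positive exactly when all roots are negative, which is the usual
    definition of the Garding cone. *)
Definition in_cone (m : nat) e d a :=
  forall j, (j <= m)%N -> 0 < d (a ^+ j * e ^+ (m - j)).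

Lemma linear_form_mul d b : linear_form d -> linear_form (fun x => d (b * x)).
Proof.
by case=> dD dZ; split=> [x y|z x]; rewrite ?mulrDr ?dD// mulrCA dZ.
Qed.

Lemma linear_form_mulr d b : linear_form d -> linear_form (fun x => d (x * b)).
Proof.
by case=> dD dZ; split=> [x y|z x]; rewrite ?mulrDl ?dD// -mulrA dZ.
Qed.

Lemma linear_form0 d : linear_form d -> d 0 = 0.
Proof. by case=> _ dZ; rewrite -[X in d X](mulr0 (io 0)) dZ mul0r. Qed.

Lemma linear_form_sum d I (r : seq I) (P : pred I) (F : I -> K) : linear_form d ->
  d (\sum_(i <- r | P i) F i) = \sum_(i <- r | P i) d (F i).
Proof. by move=> ld; apply: (big_morph d ld.1 (linear_form0 ld)). Qed.

Lemma linear_formMn d x k : linear_form d -> d (x *+ k) = d x *+ k.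
Proof.
move=> ld; elim: k => [|k IH]; first by rewrite !mulr0n linear_form0.
by rewrite !mulrSr ld.1 IH.
Qed.

Definition line_poly d m a b : {poly C} :=
  \poly_(j < m.+1) (d (a ^+ (m - j) * b ^+ j) *+ 'C(m, j)).

Lemma line_polyE d m a b T : linear_form d ->
  (line_poly d m a b).[T] = d ((a + io T * b) ^+ m).
Proof.
move=> ld; rewrite horner_poly exprDn linear_form_sum//.
apply: eq_bigr => j _; rewrite linear_formMn// exprMn -rmorphXn /= mulrCA ld.2.
by rewrite mulrnAl mulrC.
Qed.

Lemma coef_line_poly d m a b j : (j <= m)%N ->
  (line_poly d m a b)`_j = d (a ^+ (m - j) * b ^+ j) *+ 'C(m, j).
Proof. by move=> jm; rewrite coef_poly ltnS jm. Qed.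

Lemma size_line_poly d m a b : d (b ^+ m) != 0 -> size (line_poly d m a b) = m.+1.
Proof. by move=> b0; rewrite size_poly_eq// subnn expr0 mul1r binn. Qed.

Lemma lead_line_poly d m a b : d (b ^+ m) != 0 ->
  lead_coef (line_poly d m a b) = d (b ^+ m).
Proof.
move=> b0; rewrite lead_coefE size_line_poly// coef_line_poly//.
by rewrite subnn expr0 mul1r binn.
Qed.

(** The T-derivative of d((a + T e)^(m+1)) is m + 1 times d(e (a + T e)^m), and differentiation
    keeps the roots real. *)
Lemma hyperbolic_deriv m e d : linear_form d ->
  hyperbolic m.+1 e d -> hyperbolic m e (fun x => d (e * x)).
Proof.
move=> ld [e0 eR]; split=> [|a T Wa]; first by rewrite -exprS.
rewrite -(line_polyE m a e T (linear_form_mul e ld)) => rT.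
have e0' : d (e ^+ m.+1) != 0 by rewrite gt_eqF.
apply: (@deriv_real_roots _ (line_poly d m.+1 a e)).
- by rewrite size_line_poly.
- by move=> z /rootP; rewrite line_polyE//; apply: eR.
have -> : (line_poly d m.+1 a e)^`() =
    (line_poly (fun x => d (e * x)) m a e) *+ m.+1.
  apply/polyP => j; rewrite coef_deriv coefMn !coef_poly ltnS.
  case: ltnP => // jm; last by rewrite !mul0rn.
  rewrite subSS mulrCA -exprS -!mulrnA; congr (_ *+ _).
  by rewrite mulnC -mul_bin_diag mulnC.
by rewrite rootE hornerMn rT mul0rn.
Qed.

Lemma hyperbolic_derivn n r e d : linear_form d -> (r <= n)%N ->
  hyperbolic n e d -> hyperbolic (n - r) e (fun x => d (e ^+ r * x)).
Proof.
move=> ld; elim: r => [_|r IH rn] he.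
  rewrite subn0; case: he => h1 h2; split=> [|a T]; rewrite expr0 mul1r//.
  exact: h2.
have := IH (ltnW rn) he; rewrite -(subnSK rn).
move=> /(hyperbolic_deriv (linear_form_mul _ ld))[h1 h2]; split=> [|a T].
  by rewrite exprSr -mulrA.
by rewrite exprSr -mulrA; apply: h2.
Qed.

(** The leading coefficient in z is d(b^m) whatever the parameter s is, as [root_path] requires. *)
Lemma line_root_path m d P0 P1 b : linear_form d -> d (b ^+ m) != 0 ->
  (forall (s : R) z, 0 <= s < 1 -> Im z = 0 ->
     d ((P0 + io s%:C * P1 + io z * b) ^+ m) != 0) ->
  (forall z, d ((P0 + io z * b) ^+ m) = 0 -> Im z < 0) ->
  forall z, d ((P0 + P1 + io z * b) ^+ m) = 0 -> Im z <= 0.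
Proof.
move=> ld b0 noreal at0 z rz.
(* The coefficient of z^j is d((P0 + s P1)^(m-j) b^j) times a binomial, itself a polynomial in s. *)
pose Q : {poly {poly C}} :=
  \poly_(j < m.+1) (line_poly (fun x => d (x * b ^+ j)) (m - j) P0 P1 *+ 'C(m, j)).
have Qm : line_poly (fun x => d (x * b ^+ m)) (m - m) P0 P1 *+ 'C(m, m) = (d (b ^+ m))%:P.
  rewrite binn subnn; apply/polyP => -[|j]; rewrite coefC coef_poly//=.
  by rewrite !expr0 !mul1r bin0.
have szQ : size Q = m.+1 by rewrite size_poly_eq// Qm polyC_eq0.
have lQ : lead_coef Q = (d (b ^+ m))%:P.
  by rewrite lead_coefE szQ coef_poly ltnSn Qm.
have QE s y : (specialize_coefs s Q).[y] = d ((P0 + io s%:C * P1 + io y * b) ^+ m).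
  rewrite (@specialize_coefsE _ _ _ _ m.+1) ?szQ//.
  rewrite -(line_polyE m _ b y ld) horner_poly; apply: eq_bigr => j _.
  rewrite coef_poly ltn_ord hornerMn line_polyE//; exact: linear_form_mulr.
apply: (root_path b0 lQ).
- by move=> s y s01 y0; rewrite rootE QE noreal.
- by move=> y /rootP; rewrite QE rmorph0 mul0r addr0; apply: at0.
- by rewrite rootE QE rmorph1 mul1r rz.
Qed.

Lemma in_cone_line_gt0 m e d a T : linear_form d -> in_cone m e d a -> 0 <= T ->
  0 < d ((a + io T * e) ^+ m).
Proof.
move=> ld ca T0; rewrite -line_polyE// horner_poly big_ord_recl /= ltr_wpDr//.
  apply: sumr_ge0 => i _; apply: mulr_ge0; last exact: exprn_ge0.
  have := ca (m - bump 0 i)%N (leq_subr _ _); rewrite subKn// => /ltW.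
  exact: mulrn_wge0.
by rewrite subn0 expr0 !mulr1 bin0; have := ca m (leqnn _); rewrite subnn mulr1.
Qed.

Lemma in_cone_line'_gt0 m e d a T : linear_form d -> in_cone m e d a -> 0 <= T ->
  0 < d ((e + io T * a) ^+ m).
Proof.
move=> ld ca T0; rewrite -line_polyE// horner_poly big_ord_recl /= ltr_wpDr//.
  apply: sumr_ge0 => i _; apply: mulr_ge0; last exact: exprn_ge0.
  have := ca (bump 0 i)%N (ltn_ord i); rewrite mulrC => /ltW.
  exact: mulrn_wge0.
by rewrite subn0 expr0 !mulr1 bin0; have := ca 0%N (leq0n _); rewrite subn0 mul1r.
Qed.

Lemma Im0_real (z : C) : Im z = 0 -> z = (Re z)%:C.
Proof. by case: z => x y /= ->. Qed.

Lemma linear_form_exprZ m d z x : linear_form d ->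
  d ((io z * x) ^+ m) = z ^+ m * d (x ^+ m).
Proof. by move=> ld; rewrite exprMn -rmorphXn ld.2. Qed.

Lemma cone_root_lt0 m e d b T : linear_form d -> hyperbolic m e d ->
  W b -> in_cone m e d b -> d ((b + io T * e) ^+ m) = 0 -> T < 0.
Proof.
move=> ld he Wb cb rT; have T0 := Im0_real (he.2 _ _ Wb rT).
rewrite T0 -[0]/(0%:C) ltcR ltNge; apply/negP => T_ge0.
have : 0 < d ((b + io T * e) ^+ m) by apply: in_cone_line_gt0; rewrite // T0 -[0]/(0%:C) lecR.
by rewrite rT ltxx.
Qed.

Lemma i_neq0 : 'i != 0 :> C.
Proof. by rewrite eq_complex /= oner_eq0 andbF. Qed.

Lemma real_mul_i_inv (T : C) : T < 0 -> Im ('i / T) < 0.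
Proof.
case: T => x y; rewrite ltcE /= => /andP[/eqP <- x0].
rewrite expr0n addr0 mul0r add0r mul1r expr2 invfM mulrA divff ?lt_eqF//.
by rewrite mul1r invr_lt0.
Qed.

(* Garding: deform v + z b through s v + z b + i (1 - s) e. *)
Lemma hyperbolic_dir m e d b : linear_form d -> hyperbolic m e d ->
  W b -> in_cone m e d b -> hyperbolic m b d.
Proof.
move=> ld he Wb cb; have b0 : 0 < d (b ^+ m).
  by have := cb m (leqnn _); rewrite subnn mulr1.
split=> // v z Wv.
(* A bound on one side is enough: replacing v by -v turns the root z into -z. *)
suff H v' y : W v' -> d ((v' + io y * b) ^+ m) = 0 -> Im y <= 0.
  move=> rz; apply/eqP; rewrite eq_le (H _ _ Wv rz)/=.
  rewrite -oppr_le0 -ImN; apply: (H (io (-1)%:C * v)); first exact: WZ.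
  rewrite rmorphN1 rmorphN1 mulN1r rmorphN mulNr -opprD exprNn.
  by rewrite -[(-1) ^+ m]/((-1) ^+ m) -(rmorphN1 io) -rmorphXn ld.2 rz mulr0.
move=> Wv' ry.
(* For real z and s < 1, a zero would make i (1 - s) a root in the direction e of an element of W,
   although such roots are real. At s = 0, factoring out z shows that i / z is a root of b + T e,
   hence negative, so z lies on the negative imaginary axis. *)
apply: (@line_root_path m d (io 'i * e) (v' - io 'i * e) b) => //.
- by rewrite gt_eqF.
- move=> s z' /andP[s0 s1] z'0; apply/eqP => r0.
  have : Im ('i * (1 - s)%:C) = 0.
    apply: (he.2 (io s%:C * v' + io z' * b)).
      by apply: WD; [exact: WZ|rewrite (Im0_real z'0); exact: WZ].
    rewrite -r0; congr (d (_ ^+ _)); rewrite rmorphM rmorphB rmorph1 rmorphB rmorph1.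
    ring.
  by rewrite /= mul0r mul1r add0r => /eqP; rewrite subr_eq0 gt_eqF.
- move=> z' r0; have z'0 : z' != 0.
    apply/eqP => E; move: r0; rewrite E rmorph0 mul0r addr0 linear_form_exprZ//.
    by apply/eqP; rewrite mulf_eq0 expf_eq0 (negbTE i_neq0) andbF gt_eqF ?he.1.
  have : 'i / z' < 0.
    apply: (cone_root_lt0 ld he Wb cb); apply/eqP.
    rewrite -(mulrI_eq0 _ (mulfI (expf_neq0 m z'0))) -linear_form_exprZ// -r0.
    apply/eqP; congr (d (_ ^+ _)).
    by rewrite mulrDr mulrA -rmorphM mulrCA divff// mulr1 addrC.
  by move=> /real_mul_i_inv; rewrite invf_div mulrC divfK// i_neq0.
- by rewrite addrCA addrN addr0.
Qed.

(* Same deformation, rotated by a right angle: the parameters z at which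
   s c + (1 - s) e + z b is a zero are real, never vanish and start negative. *)
Lemma in_cone_dir m e d b c : linear_form d -> hyperbolic m e d -> W e ->
  W b -> in_cone m e d b -> W c -> in_cone m e d c -> in_cone m b d c.
Proof.
move=> ld he We Wb cb Wc cc; have hb := hyperbolic_dir ld he Wb cb.
have i0 := i_neq0.
suff neg y : d ((c + io y * b) ^+ m) = 0 -> y < 0.
  move=> j jm.
  have := @neg_roots_coef_gt0 _ (line_poly d m c b).
  rewrite lead_line_poly ?gt_eqF ?hb.1// => /(_ isT) H.
  have := H _ (m - j)%N; rewrite size_line_poly ?gt_eqF ?hb.1// ltnS leq_subr.
  rewrite coef_line_poly ?leq_subr// subKn// pmulrn_lgt0 ?bin_gt0 ?leq_subr//; apply=> // z.
  by move=> /rootP; rewrite line_polyE//; apply: neg.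
have c0 : 0 < d (c ^+ m) by have := cc m (leqnn _); rewrite subnn mulr1.
move=> ry; have yR := Im0_real (hb.2 _ _ Wc ry).
have y0 : y != 0.
  by apply/eqP => E; move: ry; rewrite E rmorph0 mul0r addr0 => /eqP; rewrite gt_eqF.
rewrite lt_neqAle y0/= yR -[0]/(0%:C) lecR.
have -> : Re y = Im ('i * y) by rewrite [in RHS]yR /= mul0r mul1r add0r.
have iK z : - 'i * ('i * z) = z :> C by rewrite mulrA mulNr -expr2 sqr_i opprK mul1r.
(* [line_root_path] controls imaginary parts, and here the real part of y is wanted: b is multiplied
   by -i and the variable by i. *)
apply: (@line_root_path m d e (c - e) (io (- 'i) * b)) => //.
- by rewrite linear_form_exprZ// mulf_neq0 ?expf_neq0 ?oppr_eq0// gt_eqF ?hb.1.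
- move=> s z /andP[s0 s1] z0; apply/eqP => r0.
  have s10 : 0 < 1 - s by rewrite subr_gt0.
  have Wt : W (e + io s%:C * (c - e)).
    have -> : e + io s%:C * (c - e) = io (1 - s)%:C * e + io s%:C * c.
      by rewrite rmorphB rmorph1 rmorphB rmorph1; ring.
    by apply: WD; exact: WZ.
  have r0' : d ((e + io s%:C * (c - e) + io (- 'i * z) * b) ^+ m) = 0.
    by rewrite -r0 rmorphM; congr (d (_ ^+ _)); ring.
  have := hb.2 _ _ Wt r0'; rewrite (Im0_real z0).
  have -> : Im (- 'i * (Re z)%:C) = - Re z by rewrite /=; ring.
  move=> /eqP; rewrite oppr_eq0 => /eqP rez.
  move: r0; rewrite (Im0_real z0) rez rmorph0 mul0r addr0.
  (* Only z = 0 remains, and there the point is a positive multiple of e plus a nonnegative multiple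
     of c, where d is positive because c is in the cone. *)
  have -> : e + io s%:C * (c - e) = io (1 - s)%:C * (e + io (s / (1 - s))%:C * c).
    rewrite [RHS]mulrDr [X in _ = _ + X]mulrA -rmorphM -rmorphM [(1 - s) * _]mulrCA divff ?gt_eqF// mulr1.
    by rewrite rmorphB rmorph1 rmorphB rmorph1; ring.
  rewrite linear_form_exprZ// => /eqP; rewrite mulf_eq0 expf_eq0.
  have /negbTE -> : (1 - s)%:C != 0 :> C by rewrite eq_complex /= eqxx andbT gt_eqF.
  rewrite andbF /=.
  rewrite gt_eqF// in_cone_line'_gt0// -[0]/(0%:C) lecR divr_ge0// ltW//.
- move=> z; rewrite mulrCA mulrA -rmorphM mulNr => r0.
  pose t := - ('i * z).
  have t0 : t != 0.
    apply/eqP => E; move: r0; rewrite -/t E rmorph0 mul0r addr0 => /eqP.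
    by rewrite gt_eqF ?he.1.
  have : t^-1 < 0.
    apply: (cone_root_lt0 ld he Wb cb); apply/eqP.
    rewrite -(mulrI_eq0 _ (mulfI (expf_neq0 m t0))) -linear_form_exprZ// -r0 -/t.
    apply/eqP; congr (d (_ ^+ _)).
    by rewrite mulrDr mulrA -rmorphM divff// rmorph1 mul1r addrC.
  rewrite invr_lt0 /t; case: (z) => p q; rewrite ltcE /= mul0r mul1r mul0r mul1r.
  by rewrite sub0r opprK add0r => /andP[].
- by rewrite mulrA -rmorphM [_ * - _]mulrC iK addrCA addrN addr0.
Qed.

Lemma in_cone_deriv m e d a : in_cone m.+1 e d a -> in_cone m e (fun x => d (e * x)) a.
Proof.
move=> ca j jm; have := ca j (leqW jm); rewrite subSn// exprS.
by rewrite mulrCA.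
Qed.

(** Induction on the factors: the first one, b, becomes the new direction and is absorbed into the
    linear form. Multiplication by b is then a derivative in the direction b, which preserves
    hyperbolicity and sends the cone into the cone of one degree less. *)
Lemma garding_prod_gt0 (s : seq K) e d : linear_form d -> hyperbolic (size s) e d ->
  W e -> (forall a, a \in s -> W a /\ in_cone (size s) e d a) -> 0 < d (\prod_(a <- s) a).
Proof.
elim: s e d => [|b s IH] e d ld he We cs; first by rewrite big_nil; have := he.1.
have [Wb cb] : W b /\ in_cone (size s).+1 e d b by apply: cs; rewrite inE eqxx.
have hb := hyperbolic_dir ld he Wb cb.
rewrite big_cons.
apply: (IH b (fun x => d (b * x)) (linear_form_mul b ld)) => //.
  exact: hyperbolic_deriv.
move=> a as_; have [Wa ca] : W a /\ in_cone (size s).+1 e d a.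
  by apply: cs; rewrite inE as_ orbT.
by split=> //; apply: in_cone_deriv; exact: (in_cone_dir ld he).
Qed.

(** Absorbing the power of e into d amounts to differentiating n - [size s] times along e. This
    reduces the cone given by only the first [size s] inequalities to the full cone of a polynomial
    of degree [size s]. *)
Lemma garding (s : seq K) n e d : linear_form d -> hyperbolic n e d -> W e ->
  (size s <= n)%N ->
  (forall a, a \in s -> W a /\
     forall j, (j <= size s)%N -> 0 < d (a ^+ j * e ^+ (n - j))) ->
  0 < d ((\prod_(a <- s) a) * e ^+ (n - size s)).
Proof.
move=> ld he We sn cs; rewrite mulrC.
apply: (garding_prod_gt0 (linear_form_mul (e ^+ (n - size s)) ld)) We _.
  by rewrite -{1}(subKn sn); apply: hyperbolic_derivn; rewrite ?leq_subr.
move=> a /cs[Wa ca]; split=> // j js; rewrite mulrCA -exprD addnBA// subnK//.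
exact: ca.
Qed.

End Garding.

(** * Even forms as a commutative ring, with the top coefficient as linear form *)

Section EvenSubring.
Context {R : realType} {m : nat}.
Local Notation C := R[i].

(** A new name for the type, so that the wedge product is attached to it as multiplication and not
    to all finite functions. *)
Definition wedge_ring : Type := extalg R m.

HB.instance Definition _ := GRing.Zmodule.copy wedge_ring (extalg R m).
HB.instance Definition _ := GRing.Zmodule_isNzRing.Build wedge_ring
  (@wedgeA R m) wedge1l wedge1r (@wedgeDl R m) (fun c a b => @wedgeDr R m a b c) econst1_neq0.

Lemma even_form_subring_closed : subring_closed (even_form : {pred wedge_ring}).
Proof.
split=> [|a b|a b]; [exact: even_form_const|exact: even_formB|exact: even_form_wedge].
Qed.

Record even_ext := EvenExt { even_val : wedge_ring; _ : even_form even_val }.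

HB.instance Definition _ := [isSub for even_val].
HB.instance Definition _ := [Choice of even_ext by <:].
HB.instance Definition _ :=
  GRing.SubChoice_isSubNzRing.Build wedge_ring even_form even_ext even_form_subring_closed.

Lemma even_ext_mulC : commutative (@GRing.mul even_ext).
Proof. by move=> [a ha] [b hb]; apply: val_inj; exact: even_form_wedgeC. Qed.

HB.instance Definition _ := GRing.PzSemiRing_hasCommutativeMul.Build even_ext even_ext_mulC.

Definition even_const (z : C) : even_ext := EvenExt (even_form_const z).

Lemma even_const_is_additive : zmod_morphism even_const.
Proof.
move=> x y; apply: val_inj; apply/ffunP => S; rewrite !ffunE.
by case: (S == _); rewrite ?mulr1n ?mulr0n ?subrr.
Qed.

Lemma even_const_is_multiplicative : monoid_morphism even_const.
Proof.
split; first exact: val_inj.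
move=> x y; apply: val_inj; rewrite /= [RHS]wedge_const.
by apply/ffunP => S; rewrite !ffunE -mulrnAr.
Qed.

HB.instance Definition _ :=
  GRing.isZmodMorphism.Build C even_ext even_const even_const_is_additive.
HB.instance Definition _ :=
  GRing.isMonoidMorphism.Build C even_ext even_const even_const_is_multiplicative.

Definition top_coef (a : even_ext) : C := even_val a [set: 'I_m]%SET.

Lemma top_coef_linear : linear_form even_const top_coef.
Proof.
split=> [x y|z x]; first by rewrite /top_coef ffunE.
by rewrite /top_coef /= [_ * _]wedge_const ffunE.
Qed.

Lemma even_val_inj : injective (even_val : even_ext -> extalg R m).
Proof. exact: val_inj. Qed.

Lemma even_valM (a b : even_ext) : even_val (a * b) = wedge (even_val a) (even_val b).
Proof. by []. Qed.

Lemma even_valX (a : even_ext) k : even_val (a ^+ k) = wedge_exp (even_val a) k.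
Proof. by elim: k => [//|k IH]; rewrite exprS even_valM IH. Qed.

Lemma even_val_constM z (a : even_ext) :
  even_val (even_const z * a) = escale z (even_val a).
Proof. exact: wedge_const. Qed.

Lemma even_valD (a b : even_ext) : even_val (a + b) = even_val a + even_val b.
Proof. by []. Qed.

Lemma even_valN (a : even_ext) : even_val (- a) = - even_val a.
Proof. by []. Qed.

Lemma even_val_sum I (r : seq I) (P : pred I) (F : I -> even_ext) :
  even_val (\sum_(i <- r | P i) F i) = \sum_(i <- r | P i) even_val (F i).
Proof. exact: (big_morph even_val even_valD). Qed.

End EvenSubring.
Arguments even_ext : clear implicits.

(** * The n-th power of a (1,1)-form as a determinant, for abstract generators *)

Section AlternatingPairs.
Context {C K : comNzRingType} {n : nat}.
Variable io : {rmorphism C -> K}.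
Variable E : 'I_n -> 'I_n -> K.
Hypothesis E_row : forall j l l', E j l * E j l' = 0.
Hypothesis E_col : forall j j' l, E j l * E j' l = 0.
Hypothesis E_exchange : forall j l j' l', E j l * E j' l' = - (E j l' * E j' l).

Lemma expr_add_sqr0 (x y : K) p : x * x = 0 ->
  (x + y) ^+ p.+1 = y ^+ p.+1 + x * y ^+ p *+ p.+1.
Proof.
move=> x0; elim: p => [|p IH]; first by rewrite !expr1 expr0 mulr1 addrC.
rewrite exprS IH mulrDr mulrDl -exprS mulrDl -!mulrnAr mulrA x0 mul0r add0r.
rewrite !mulrnAr mulrCA -exprS (addrC (x * _)) -addrA; congr (_ + _).
Qed.

(** In the expanded power only products of distinct terms survive, and each ordering contributes
    once, whence the factorial. *)
Lemma expr_sum_sqr0 (I : eqType) (r : seq I) (Y : I -> K) : (forall i, Y i * Y i = 0) ->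
  (\sum_(i <- r) Y i) ^+ size r = (\prod_(i <- r) Y i) *+ (size r)`!.
Proof.
move=> Y0; elim: r => [|i r IH]; first by rewrite !big_nil expr0.
rewrite !big_cons /= expr_add_sqr0//.
have -> : (\sum_(j <- r) Y j) ^+ (size r).+1 = 0.
  rewrite exprS IH mulrnAr mulr_suml [X in X *+ _](_ : _ = 0) ?mul0rn//.
  rewrite [LHS]big_seq; apply: big1 => j jr.
  by rewrite (big_rem j jr) /= mulrA Y0 mul0r.
by rewrite add0r IH mulrnAr -mulrnA mulnC.
Qed.

Lemma prod_E_tperm (s : 'S_n) a b : a != b ->
  \prod_j E j ((tperm a b * s)%g j) = - \prod_j E j (s j).
Proof.
move=> ab; have ba : b != a by rewrite eq_sym.
rewrite (bigD1 a)//= [in RHS](bigD1 a)//= (bigD1 b)//= [in RHS](bigD1 b)//=.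
rewrite !mulrA !permM tpermL tpermR E_exchange mulNr; congr (- (_ * _)).
by apply: eq_bigr => j /andP[ja jb]; rewrite permM tpermD// eq_sym.
Qed.

Lemma prod_E_perm (s : 'S_n) : \prod_j E j (s j) = (-1) ^+ s * \prod_j E j j.
Proof.
have [ts -> ds] := prod_tpermP s; elim: ts ds => [_|[a b] ts IH /= /andP[ab dts]].
  by rewrite big_nil odd_perm1 mul1r; apply: eq_bigr => j _; rewrite perm1.
by rewrite big_cons prod_E_tperm// IH// odd_permM odd_tperm ab /= signrN mulNr.
Qed.

(** The row sums square to zero, so the power is n! times their product. Expanding it over choices
    of columns, a repeated column gives 0 by [E_col] and a permutation contributes its sign: this is
    the Leibniz formula. *)
Lemma expr_sum_det (h : 'M[C]_n) :
  (\sum_j \sum_l io (h j l) * E j l) ^+ n = io (\det h) * (\prod_j E j j) *+ n`!.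
Proof.
have Y0 (j : 'I_n) :
    (\sum_l io (h j l) * E j l) * (\sum_l io (h j l) * E j l) = 0.
  rewrite mulr_suml big1// => l _; rewrite mulr_sumr big1// => l' _.
  by rewrite mulrACA E_row mulr0.
have := expr_sum_sqr0 (index_enum 'I_n) Y0.
have -> : size (index_enum 'I_n) = n by rewrite -[RHS]size_enum_ord enumT.
move=> ->; congr (_ *+ _).
rewrite bigA_distr_bigA /= (bigID (fun f : {ffun 'I_n -> 'I_n} => injectiveb f)) /=.
rewrite addrC big1 ?add0r; last first.
  move=> f /injectivePn[j [j' jj' fjj']].
  rewrite (bigD1 j)//= (bigD1 j') 1?eq_sym//= mulrA mulrACA fjj' E_col.
  by rewrite mulr0 mul0r.
rewrite (reindex (@pval _)) /=; last first.
  pose in_Sn := insubd (1%g : 'S_n).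
  by exists in_Sn => /= f Uf; [apply: val_inj|]; apply: insubdK.
rewrite rmorph_sum mulr_suml; apply: eq_big => /= [s|s _]; first by rewrite (valP s).
rewrite big_split /= rmorphM rmorph_sign rmorph_prod [in RHS]mulrAC mulrC.
transitivity (\prod_i E i (s i) * \prod_i io (h i (s i))); last by rewrite prod_E_perm.
by congr (_ * _); apply: eq_bigr => j _; rewrite pvalE.
Qed.

End AlternatingPairs.

(** * (1,1)-forms in coordinates and their top power *)

Section HermitianForms.
Context {R : realType} {n : nat}.
Local Notation C := R[i].
Local Notation L := (extalg R (n * 2)).
Local Notation K := (even_ext R (n * 2)).
Local Notation io := (@even_const R (n * 2)).
Implicit Types (h g p : 'M[C]_n).

Lemma homogeneous_dz j : homogeneous 1 (dz j : L).
Proof. by apply: homogeneousD; [|apply: homogeneousZ]; exact: homogeneous_dx. Qed.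

Lemma homogeneous_dzbar j : homogeneous 1 (dzbar j : L).
Proof.
rewrite /dzbar -escaleN; apply: homogeneousD; [|apply: homogeneousZ]; exact: homogeneous_dx.
Qed.

Arguments homogeneous_dz j S _ : clear implicits.
Arguments homogeneous_dzbar j S _ : clear implicits.

Lemma even_form_pair j l : even_form (wedge (dz j) (dzbar l) : L).
Proof.
apply: (@even_form_homogeneous _ _ _ 2) => //.
exact: (homogeneousM (homogeneous_dz j) (homogeneous_dzbar l)).
Qed.

(** The factor i/2 normalises the diagonal pairs to dx_j /\ dy_j. *)
Definition dz_pair j l : K := io ('i / 2%:R) * EvenExt (even_form_pair j l).

Lemma even_self_opp (x : K) : x = - x -> x = 0.
Proof.
move=> /(congr1 even_val)/ffunP E; apply: even_val_inj; apply/ffunP => S.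
have /eqP := E S; rewrite !ffunE -subr_eq0 opprK -mulr2n -mulr_natr.
by rewrite mulf_eq0 pnatr_eq0 orbF => /eqP.
Qed.

Lemma dz_pair_exchange j l j' l' :
  dz_pair j l * dz_pair j' l' = - (dz_pair j l' * dz_pair j' l).
Proof.
rewrite /dz_pair mulrACA [in RHS]mulrACA -mulrN; congr (_ * _); apply: even_val_inj.
rewrite even_valN !even_valM /=.
by apply: one_form_exchange; rewrite ?homogeneous_dz ?homogeneous_dzbar//;
  [exact: homogeneous_dz|exact: homogeneous_dzbar|exact: homogeneous_dz|exact: homogeneous_dzbar].
Qed.

Lemma dz_pair_row j l l' : dz_pair j l * dz_pair j l' = 0.
Proof. by apply: even_self_opp; rewrite {1}dz_pair_exchange [in RHS]mulrC. Qed.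

Lemma dz_pair_col j j' l : dz_pair j l * dz_pair j' l = 0.
Proof. by apply: even_self_opp; rewrite {1}dz_pair_exchange. Qed.

Definition hform h : K := \sum_j \sum_l io (h j l) * dz_pair j l.

Lemma even_val_hform h : even_val (hform h) = form11 h.
Proof.
rewrite /form11 escale_sum even_val_sum; apply: eq_bigr => j _.
rewrite escale_sum even_val_sum; apply: eq_bigr => l _.
by rewrite !even_val_constM escaleA escaleA mulrC.
Qed.

Definition basis_form (A : {set 'I_(n * 2)}) : L := [ffun S => (S == A)%:R].

Lemma wedge_basis (A B : {set 'I_(n * 2)}) :
  (forall p q : 'I_(n * 2), p \in A -> q \in B -> (p < q)%N) ->
  wedge (basis_form A) (basis_form B) = basis_form (A :|: B)%SET.
Proof.
move=> AB; have dAB : (A :&: B = finset.set0)%SET.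
  apply/setP => x; rewrite !inE; apply/negbTE/negP => /andP[xA xB].
  by have := AB x x xA xB; rewrite ltnn.
apply/ffunP => S; rewrite !ffunE.
transitivity (\sum_(D : {set 'I_(n * 2)} | (D \subset S) && (D == A))
    (S :\: D == B)%SET%:R : C).
  rewrite big_mkcondr /=; apply: eq_bigr => D DS; rewrite !ffunE.
  have [->|_] := eqVneq D A; last by rewrite mulr0 mul0r.
  have [->|_] := eqVneq (S :\: A)%SET B; last by rewrite mulr0.
  rewrite inversionsE big1 ?expr0 ?mulr1// => i iA; rewrite big1// => k kB.
  by rewrite ltnNge ltnW// AB.
have [AS|AS] := boolP (A \subset S); last first.
  rewrite big_pred0; last by move=> D; apply/negbTE/negP => /andP[+ /eqP E]; rewrite E (negbTE AS).
  have [E|//] := eqVneq S (A :|: B)%SET.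
  by move: AS; rewrite E finset.subsetUl.
rewrite (eq_bigl (pred1 A)) ?big_pred1_eq; last first.
  by move=> D /=; have [->|_] := eqVneq D A; rewrite ?AS ?andbF.
congr (nat_of_bool _)%:R; apply/eqP/eqP => [<-|->].
  by rewrite finset.setDE finset.setUIr finset.setUCr finset.setIT; apply/esym/finset.setUidPr.
by rewrite finset.setDUl finset.setDv finset.set0U; apply/finset.setDidPl; rewrite -finset.setI_eq0 finset.setIC dAB.
Qed.

Lemma dz_pair_diag j :
  even_val (dz_pair j j) = wedge (dx (xi j)) (dx (yi j)).
Proof.
rewrite even_val_constM /= /dz /dzbar -escaleN.
have dd i : wedge (dx i) (dx i) = 0 :> L.
  have /ffunP E := one_form_wedgeC (@homogeneous_dx R _ i) (homogeneous_dx i).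
  apply/ffunP => S; have /eqP := E S; rewrite [X in _ == X]ffunE -subr_eq0 opprK -mulr2n -mulr_natr.
  by rewrite mulf_eq0 pnatr_eq0 orbF => /eqP ->; rewrite ffunE.
rewrite wedgeDl !wedgeDr !wedgeZl !wedgeZr !dd !escale0 addr0 add0r.
rewrite (one_form_wedgeC (homogeneous_dx (yi j)) (homogeneous_dx (xi j))).
apply/ffunP => S; rewrite !ffunE; set w := (\sum_(_ | _) _).
have i2 : 'i * 'i = -1 :> C by rewrite -expr2 sqr_i.
transitivity (- ('i * 'i) * w); last by rewrite i2 opprK mul1r.
by rewrite mulNr mulrN -mulr2n mulrnAr -mulr_natr mulrAC divfK ?pnatr_eq0// mulrN mulrA mulNr.
Qed.

(** The interleaved order x_1, y_1, x_2, y_2, ... of the coordinates makes each new factor come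
    after all earlier ones, so no sign ever appears. *)
Lemma top_prod_dz_pair : top_coef (\prod_j dz_pair j j) = 1.
Proof.
have H r (rn : (r <= n)%N) :
    even_val (\prod_(j < r) dz_pair (widen_ord rn j) (widen_ord rn j)) =
    basis_form [set i : 'I_(n * 2) | (i < r * 2)%N]%SET.
  elim: r rn => [|r IH] rn.
    rewrite big_ord0; apply/ffunP => S; rewrite !ffunE.
    by congr (_ == _)%:R; apply/setP => i; rewrite !inE.
  rewrite big_ord_recr [LHS]even_valM dz_pair_diag.
  have -> : \prod_(i < r) dz_pair (widen_ord rn (widen_ord (leqnSn r) i))
       (widen_ord rn (widen_ord (leqnSn r) i)) =
     \prod_(j < r) dz_pair (widen_ord (ltnW rn) j) (widen_ord (ltnW rn) j).
    apply: eq_bigr => j _.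
    have -> : widen_ord rn (widen_ord (leqnSn r) j) = widen_ord (ltnW rn) j by exact: val_inj.
    by [].
  rewrite (IH (ltnW rn)) wedgeA.
  have -> : wedge (basis_form [set i : 'I_(n * 2) | (i < r * 2)%N]%SET)
     (dx (xi (widen_ord rn ord_max))) =
     basis_form [set i : 'I_(n * 2) | (i < (r * 2).+1)%N]%SET.
    rewrite -[dx _]/(basis_form [set _]%SET) wedge_basis => [|p q]; last first.
      by rewrite !inE => pr /eqP ->.
    congr basis_form; apply/setP => i; rewrite !inE ltnS [RHS]leq_eqVlt orbC.
    by rewrite -val_eqE.
  rewrite -[dx _]/(basis_form [set _]%SET) wedge_basis => [|p q]; last first.
    by rewrite !inE => pr /eqP ->.
  congr basis_form; apply/setP => i; rewrite !inE ltnS [RHS]leq_eqVlt orbC.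
  by rewrite -val_eqE.
have := H n (leqnn n); rewrite /top_coef => E.
have -> : \prod_j dz_pair j j =
    \prod_(j < n) dz_pair (widen_ord (leqnn n) j) (widen_ord (leqnn n) j).
  apply: eq_bigr => j _.
  have -> : widen_ord (leqnn n) j = j by exact: val_inj.
  by [].
rewrite E ffunE; suff -> : [set: 'I_(n * 2)]%SET = [set i : 'I_(n * 2) | (i < n * 2)%N]%SET.
  by rewrite eqxx.
by apply/setP => i; rewrite !inE ltn_ord.
Qed.

Lemma top_hform_det h : top_coef (hform h ^+ n) = (\det h) *+ n`!.
Proof.
rewrite /hform (expr_sum_det _ dz_pair_row dz_pair_col dz_pair_exchange).
rewrite (linear_formMn _ _ top_coef_linear) top_coef_linear.2 top_prod_dz_pair.
by rewrite mulr1.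
Qed.

End HermitianForms.
Arguments homogeneous_dz {R n} j S _.
Arguments homogeneous_dzbar {R n} j S _.

(** * Hermitian matrices, hyperbolicity of the determinant and mixed positivity *)

Section Positivity.
Context {R : realType} {n : nat}.
Local Notation C := R[i].
Local Notation L := (extalg R (n * 2)).
Local Notation K := (even_ext R (n * 2)).
Local Notation io := (@even_const R (n * 2)).
Implicit Types (h g p : 'M[C]_n) (v : 'I_n -> C).

Definition hermitian_mx h := forall j l, h j l = conjc (h l j).

Definition quad_form h v : C := \sum_j \sum_l v j * h j l * conjc (v l).

Definition posdef_mx h := forall v, (exists j, v j != 0) -> 0 < quad_form h v.

Definition adjoint_mx h : 'M[C]_n := \matrix_(j, l) conjc (h l j).

Lemma quad_formD h g v : quad_form (h + g) v = quad_form h v + quad_form g v.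
Proof.
rewrite /quad_form -big_split; apply: eq_bigr => j _; rewrite -big_split.
by apply: eq_bigr => l _; rewrite mxE /=; ring.
Qed.

Lemma quad_formZ z h v : quad_form (z *: h) v = z * quad_form h v.
Proof.
rewrite /quad_form mulr_sumr; apply: eq_bigr => j _; rewrite mulr_sumr.
by apply: eq_bigr => l _; rewrite mxE /=; ring.
Qed.

Lemma quad_form_adjoint h v : quad_form (adjoint_mx h) v = conjc (quad_form h v).
Proof.
rewrite /quad_form rmorph_sum exchange_big; apply: eq_bigr => j _ /=.
rewrite rmorph_sum; apply: eq_bigr => l _ /=.
by rewrite mxE !rmorphM /= conjcK; ring.
Qed.

Lemma hermitian_adjoint h : hermitian_mx h -> adjoint_mx h = h.
Proof. by move=> hh; apply/matrixP => j l; rewrite mxE -hh. Qed.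

Lemma hermitian_quad_form h v : hermitian_mx h -> Im (quad_form h v) = 0.
Proof.
move=> /hermitian_adjoint E; have := quad_form_adjoint h v; rewrite E.
by case: (quad_form h v) => x y /= [/eqP]; rewrite -addr_eq0 -mulr2n mulrn_eq0 /= => /eqP.
Qed.

Lemma quad_form1 v : quad_form 1%:M v = \sum_j `|v j| ^+ 2.
Proof.
apply: eq_bigr => j _; rewrite (bigD1 j)//= big1 ?addr0.
  by rewrite mxE eqxx mulr1 sqr_normc.
by move=> l lj; rewrite mxE eq_sym (negbTE lj) mulr0 mul0r.
Qed.

Lemma posdef1 : posdef_mx 1%:M.
Proof.
move=> v [j vj]; rewrite quad_form1 (bigD1 j)//= ltr_wpDr//.
  by apply: sumr_ge0 => i _; rewrite exprn_ge0.
by rewrite exprn_gt0// normr_gt0.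
Qed.

Lemma hformD h g : hform (h + g) = hform h + hform g :> K.
Proof.
rewrite /hform -big_split; apply: eq_bigr => j _; rewrite -big_split.
by apply: eq_bigr => l _; rewrite mxE rmorphD mulrDl.
Qed.

Lemma hformZ z h : hform (z *: h) = io z * hform h :> K.
Proof.
rewrite /hform mulr_sumr; apply: eq_bigr => j _; rewrite mulr_sumr.
by apply: eq_bigr => l _; rewrite mxE rmorphM mulrA.
Qed.

Lemma conjc_i : conjc ('i : C) = - 'i.
Proof. by apply/eqP; rewrite eq_complex /= oppr0 !eqxx. Qed.

Lemma econj_dz j : econj (dz j : L) = dzbar j.
Proof.
rewrite econjD econjZ !econj_dx /dzbar -escaleN; congr (_ + escale _ _).
exact: conjc_i.
Qed.

Lemma econj_dzbar j : econj (dzbar j : L) = dz j.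
Proof.
rewrite /dzbar -escaleN econjD econjZ !econj_dx; congr (_ + escale _ _).
by rewrite rmorphN [X in - X]conjc_i opprK.
Qed.

Lemma econj_dz_pair j l : econj (even_val (dz_pair j l)) = even_val (dz_pair l j) :> L.
Proof.
have E a ha : even_val (@EvenExt R (n * 2) a ha) = a by [].
rewrite !even_val_constM econjZ !E econjM econj_dz econj_dzbar.
rewrite (one_form_wedgeC (homogeneous_dzbar j) (homogeneous_dz l)).
apply/ffunP => S; rewrite !ffunE mulrN -mulNr; congr (_ * _).
rewrite rmorphM fmorphV rmorph_nat -mulNr; congr (_ / _).
by rewrite [X in - X]conjc_i opprK.
Qed.

Lemma econj_hform h : econj (even_val (hform h)) = even_val (hform (adjoint_mx h)) :> L.
Proof.
rewrite even_val_sum econj_sum [in RHS]even_val_sum.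
under eq_bigr do rewrite even_val_sum econj_sum.
under [in RHS]eq_bigr do rewrite even_val_sum.
rewrite exchange_big; apply: eq_bigr => j _; apply: eq_bigr => l _.
by rewrite even_val_constM econjZ econj_dz_pair even_val_constM mxE.
Qed.

Definition real_form (a : K) := econj (even_val a) = even_val a.

Lemma real_formM a b : real_form a -> real_form b -> real_form (a * b).
Proof. by move=> ra rb; rewrite /real_form even_valM econjM ra rb. Qed.

Lemma real_form1 : real_form 1.
Proof. by apply/ffunP => S; rewrite !ffunE rmorphMn rmorph1. Qed.

Lemma real_formX a k : real_form a -> real_form (a ^+ k).
Proof.
move=> ra; elim: k => [|k IH]; first exact: real_form1.
by rewrite exprS; apply: real_formM.
Qed.

Lemma real_form_top a : real_form a -> Im (top_coef a) = 0.
Proof.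
move=> /ffunP/(_ [set: 'I_(n * 2)]%SET); rewrite ffunE /top_coef.
by case: (even_val a _) => x y /= [/eqP]; rewrite -subr_eq0 -opprD oppr_eq0 -mulr2n mulrn_eq0 /= => /eqP.
Qed.

Lemma hermitian_real_form h : hermitian_mx h -> real_form (hform h).
Proof. by move=> /hermitian_adjoint hh; rewrite /real_form econj_hform hh. Qed.

(** Averaging h with its adjoint represents the same form when that form is real. This gives a
    Hermitian representative without appeal to uniqueness of coefficients, and keeps every positive
    value of the quadratic form. *)
Lemma hermitian_part h : real_form (hform h) ->
  exists g, [/\ hermitian_mx g, hform g = hform h :> K & forall v, 0 < quad_form h v ->
    quad_form g v = quad_form h v].
Proof.
move=> rh; exists (2%:R^-1 *: (h + adjoint_mx h)); split.
- move=> j l; have E x y : conjc (2%:R^-1 * (x + y)) = 2%:R^-1 * (conjc x + conjc y) :> C.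
    by rewrite rmorphM rmorphD fmorphV rmorph_nat.
  rewrite !mxE E conjcK.
  by rewrite [_ + h j l]addrC.
- rewrite hformZ hformD; have -> : hform (adjoint_mx h) = hform h :> K.
    by apply: even_val_inj; rewrite -econj_hform rh.
  by rewrite -mulr2n mulrnAr -mulrnAl -rmorphMn -mulr_natr mulVf ?pnatr_eq0// rmorph1 mul1r.
- move=> v; rewrite quad_formZ quad_formD quad_form_adjoint ltcE /= => /andP[/eqP i0 _].
  have -> : conjc (quad_form h v) = quad_form h v.
    by move: i0; case: (quad_form h v) => x y /= ->; rewrite oppr0.
  by rewrite -mulr2n mulrnAr -mulrnAl -mulr_natr mulVf ?pnatr_eq0// mul1r.
Qed.

(** The top power is n! det(h + T g), so a zero yields a null vector v. When g is positive definite,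
    this exhibits -T as the quotient of the two quadratic forms at v, which locates the roots. *)
Lemma hform_root h g T : top_coef ((hform h + io T * hform g) ^+ n) = 0 ->
  exists2 v : 'I_n -> C, (exists j, v j != 0) & quad_form h v + T * quad_form g v = 0.
Proof.
rewrite -hformZ -hformD top_hform_det => /eqP; rewrite mulrn_eq0 (gtn_eqF (fact_gt0 _)) /= => /det0P[v v0 vh].
exists (v 0).
  apply/existsP; apply: contraNT v0 => /existsPn vj; apply/eqP/rowP => j.
  by rewrite mxE; apply/eqP; have := vj j; rewrite negbK.
rewrite -quad_formZ -quad_formD /quad_form exchange_big big1// => l _ /=.
rewrite -mulr_suml; have /rowP/(_ l) := vh; rewrite !mxE => ->.
by rewrite mul0r.
Qed.

Lemma posdef_coef_gt0 p g : posdef_mx p -> posdef_mx g -> 0 < top_coef (hform g ^+ n) ->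
  forall j, (j <= n)%N -> 0 < top_coef (hform p ^+ j * hform g ^+ (n - j)).
Proof.
move=> pp pg g0 j jn.
have := @neg_roots_coef_gt0 _ (line_poly top_coef n (hform p) (hform g)).
rewrite lead_line_poly ?gt_eqF// => /(_ g0) H.
have := H _ (n - j)%N; rewrite size_line_poly ?gt_eqF// ltnS leq_subr.
rewrite coef_line_poly ?leq_subr// subKn// pmulrn_lgt0 ?bin_gt0 ?leq_subr//; apply => //.
move=> T /rootP; rewrite (line_polyE _ _ _ _ top_coef_linear) => /hform_root[v v0 E].
have gv := pg _ v0; have -> : T = - (quad_form p v / quad_form g v).
  by apply/(mulIf (lt0r_neq0 gv)); rewrite mulNr divfK ?gt_eqF//; apply/eqP; rewrite -addr_eq0 addrC E.
by rewrite oppr_lt0 divr_gt0// pp.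
Qed.

(** Apply [posdef_coef_gt0] in the direction of the identity matrix, whose determinant is known. *)
Lemma posdef_top_gt0 g : posdef_mx g -> 0 < top_coef (hform g ^+ n).
Proof.
move=> pg; have t1 : 0 < top_coef (hform (1%:M : 'M[C]_n) ^+ n).
  by rewrite top_hform_det det1 pmulrn_lgt0 ?fact_gt0.
by have := posdef_coef_gt0 pg posdef1 t1 (leqnn n); rewrite subnn mulr1.
Qed.

Definition hermitian_form (a : K) := exists2 h, hermitian_mx h & a = hform h.

Lemma hermitian_formD a b : hermitian_form a -> hermitian_form b -> hermitian_form (a + b).
Proof.
move=> [h hh ->] [g hg ->]; exists (h + g); last by rewrite hformD.
by move=> j l; rewrite !mxE rmorphD /= -hh -hg.
Qed.

Lemma hermitian_formZ (r : R) a : hermitian_form a -> hermitian_form (io r%:C * a).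
Proof.
move=> [h hh ->]; exists (r%:C *: h); last by rewrite hformZ.
move=> j l; rewrite !mxE.
have -> : conjc (r%:C * h l j) = conjc r%:C * conjc (h l j) by exact: rmorphM.
by rewrite conjc_real -hh.
Qed.

Lemma hform_hyperbolic g : posdef_mx g ->
  hyperbolic io hermitian_form n (hform g) top_coef.
Proof.
move=> pg; split=> [|a T [h hh ->]]; first exact: posdef_top_gt0.
move=> /hform_root[v v0 E]; have gv := pg _ v0.
have -> : T = - (quad_form h v / quad_form g v).
  by apply/(mulIf (lt0r_neq0 gv)); rewrite mulNr divfK ?gt_eqF//; apply/eqP; rewrite -addr_eq0 addrC E.
rewrite (Im0_real (hermitian_quad_form v hh)).
move: gv; rewrite ltcE /= => /andP[/eqP /Im0_real -> _].
by rewrite -fmorphV -rmorphM -rmorphN.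
Qed.

(** The limit e -> 0 without topology. In R[i] a positive number is real, so e = 1 and e = 2 already
    force Im x = 0; if Re x < 0, a suitable e brings the sum to Re x / 2, a contradiction. *)
Lemma ge0_of_perturbation (x y : C) : (forall e : R, 0 < e -> 0 < x + e%:C * y) -> 0 <= x.
Proof.
move=> H; have iH e : 0 < e -> Im x + e * Im y = 0 /\ 0 < Re x + e * Re y.
  move=> /H; case: x {H} => a b; case: y => c d; rewrite ltcE /= => /andP[/eqP E1].
  by rewrite !mul0r addr0 in E1 *; rewrite subr0.
have Ix : Im x = 0.
  have [E1 _] := iH 1 ltr01; have [E2 _] := iH 2 (ltr0n _ 2).
  by move: E1 E2; lra.
rewrite lecE /= Ix eqxx /= leNgt; apply/negP => x0.
have y0 : 0 < Re y by have [_] := iH 1 ltr01; move: x0; lra.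
have [|_] := iH (- Re x / Re y / 2); first by rewrite !divr_gt0// oppr_gt0.
suff -> : Re x + - Re x / Re y / 2 * Re y = Re x / 2 by move: x0; lra.
by field; rewrite gt_eqF.
Qed.

(** A semidefinite p need not lie in the open cone, but p + e g does for every e > 0. Garding's
    inequality applies to the latter, and its left side is affine in e. *)
Lemma hform_mixed_ge0 g p (s : seq K) : hermitian_mx g -> posdef_mx g ->
  hermitian_mx p -> (forall v, 0 <= quad_form p v) -> (size s < n)%N ->
  (forall a, a \in s -> hermitian_form a /\
     forall j, (j <= (size s).+1)%N -> 0 < top_coef (a ^+ j * hform g ^+ (n - j))) ->
  0 <= top_coef (hform p * (\prod_(a <- s) a) * hform g ^+ (n - (size s).+1)).
Proof.
move=> hg pg hp p0 sn cs.
apply: (@ge0_of_perturbation _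
  (top_coef (hform g * (\prod_(a <- s) a) * hform g ^+ (n - (size s).+1)))) => e e0.
have Hg : hermitian_form (hform g) by exists g.
have Hp : hermitian_form (hform (p + e%:C *: g)).
  by rewrite hformD hformZ; apply: hermitian_formD; [exists p|exact: hermitian_formZ].
have Pp : posdef_mx (p + e%:C *: g).
  move=> v /pg gv; rewrite quad_formD quad_formZ ltr_wpDl// mulr_gt0//.
  by rewrite -[0]/(0%:C) ltcR.
have := garding hermitian_formD hermitian_formZ top_coef_linear (hform_hyperbolic pg) Hg.
move=> /(_ (hform (p + e%:C *: g) :: s)) /= /(_ sn); rewrite big_cons hformD hformZ.
rewrite !mulrDl top_coef_linear.1 -!mulrA top_coef_linear.2; apply=> a.
rewrite inE => /predU1P[->|/cs//]; split; first by rewrite -hformZ -hformD.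
move=> j js; rewrite -hformZ -hformD; apply: posdef_coef_gt0 => //.
  exact: posdef_top_gt0.
exact: leq_trans js sn.
Qed.

End Positivity.

(** * Linearity and positivity of iterated integrals *)

Section IteratedIntegral.
Context {R : realType} {m : nat}.
Local Notation E := 'rV[R]_m.
Local Notation mu := (@lebesgue_measure R).
Implicit Types (f g : E -> R) (x y : E) (i j : 'I_m) (s T : seq 'I_m).

Definition unif_cont f := forall e : R, 0 < e ->
  exists2 d : R, 0 < d & forall x y, `|x - y| < d -> `|f x - f y| < e.

(** [T] lists the coordinates already integrated out. An iterated integral is constant along them,
    so bounded support is only asked for in the others. *)
Definition supp_bounded T f :=
  exists B : R, forall x i, i \notin T -> B < `|x 0 i| -> f x = 0.

Lemma coord_le_norm x i : `|x 0 i| <= `|x|.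
Proof.
rewrite [leRHS]mx_normrE.
exact: (@le_bigmax _ _ _ 0 (fun ij : 'I_1 * 'I_m => `|x ij.1 ij.2|) (0, i)).
Qed.

Lemma norm_dir_le i : `|dir i : E| <= 1.
Proof.
rewrite [leLHS]mx_normrE; apply/bigmax_leP; split=> //= -[j k] _ /=.
by rewrite mxE; case: (_ && _); rewrite ?normr1 ?normr0.
Qed.

Lemma coord_dir x r i j : (x + r *: dir i) 0 j = x 0 j + r * (j == i)%:R.
Proof. by rewrite !mxE eqxx. Qed.

Lemma unif_cont_line f x i : unif_cont f -> continuous (fun r : R => f (x + r *: dir i)).
Proof.
move=> uf r; apply/cvgrPdist_lt => e e0; have [d d0 H] := uf e e0.
apply/nbhs_ballP; exists d => //= t rt; apply: H.
rewrite opprD addrACA subrr add0r -scalerBl normrZ (le_lt_trans _ rt)//.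
by rewrite ler_piMr// norm_dir_le.
Qed.

Lemma line_restrict f x i (B : R) : (forall y, B < `|y 0 i| -> f y = 0) ->
  (fun r => f (x + r *: dir i)) =
  (fun r => f (x + r *: dir i)) \_ `[- B - x 0 i, B - x 0 i]%classic.
Proof.
move=> fB; apply/funext => r; rewrite patchE; case: ifPn => // /negP rB.
apply: fB; rewrite coord_dir eqxx mulr1 ltNge; apply/negP; rewrite ler_norml => /andP[h1 h2].
by apply: rB; rewrite inE /= in_itv /=; apply/andP; split; lra.
Qed.

Lemma line_integrable f x i (B : R) : unif_cont f ->
  (forall y, B < `|y 0 i| -> f y = 0) ->
  mu.-integrable setT (EFin \o (fun r => f (x + r *: dir i))).
Proof.
move=> uf fB; rewrite (line_restrict x fB) -restrict_EFin.
apply/(integrable_mkcond _ _).1 => //; apply: continuous_compact_integrable.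
  exact: segment_compact.
exact/continuous_subspaceT/unif_cont_line.
Qed.

Lemma line_integral_unif_cont f i (B : R) : unif_cont f ->
  (forall y, B < `|y 0 i| -> f y = 0) ->
  unif_cont (fun x => \int[mu]_r f (x + r *: dir i)).
Proof.
(* The margin 1 in [B'] absorbs |x_i - y_i| < 1, so both integrands vanish outside one interval of
   length 2 B'. The extra 1 in the denominator of [e'] makes the final inequality strict. *)
move=> uf fB e e0; pose B' := `|B| + 1.
pose e' := e / (2 * B' + 1); have B'0 : 0 < B' by rewrite ltr_wpDl.
have den0 : 0 < 2 * B' + 1 by rewrite addr_gt0// mulr_gt0.
have e'0 : 0 < e' by rewrite divr_gt0.
have [d d0 H] := uf e' e'0.
exists (Num.min d 1) => [|x y]; first by rewrite lt_min d0 ltr01.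
rewrite lt_min => /andP[xyd xy1].
rewrite -RintegralB//; [|exact: (line_integrable _ uf fB)..].
pose h r := f (x + r *: dir i) - f (y + r *: dir i).
have hI : mu.-integrable setT (EFin \o h).
  have := integrableB measurableT (line_integrable x uf fB) (line_integrable y uf fB).
  by congr (integrable _ _ _); apply/funext.
rewrite (le_lt_trans (le_normr_Rintegral _ hI))//.
pose D := `[- B' - x 0 i, B' - x 0 i]%classic : set R.
have hD : (fun r => `|h r|) = (fun r => `|h r|) \_ D.
  apply/funext => r; rewrite patchE; case: ifPn => // /negP rD.
  have xyi : `|x 0 i - y 0 i| < 1.
    by rewrite (le_lt_trans _ xy1)// -[x 0 i - _]/(_ + _) (le_trans _ (coord_le_norm (x - y) i))// !mxE.
  have big (z : E) : B' - 1 < `|z 0 i + r| -> f (z + r *: dir i) = 0.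
    move=> zB; apply: fB; rewrite coord_dir eqxx mulr1.
    by rewrite (le_lt_trans _ zB)// addrK ler_norm.
  have xB : B' < `|x 0 i + r|.
    rewrite ltNge; apply/negP; rewrite ler_norml => /andP[h1 h2].
    by apply: rD; rewrite /D inE /= in_itv /=; apply/andP; split; lra.
  rewrite /h !big ?subrr ?normr0//; last by move: xB; lra.
  have : `|x 0 i + r| <= `|x 0 i - y 0 i| + `|y 0 i + r|.
    by apply: le_trans (ler_normD _ _); rewrite addrA subrK.
  by move: xB xyi; lra.
rewrite hD -Rintegral_mkcond.
have hc : continuous h.
  by move=> r; apply: cvgB; apply: unif_cont_line.
have := @le_Rintegral _ _ _ mu D (fun r => `|h r|) (cst e').
move=> /(_ _ _ _ _)/le_lt_trans -> //.
- exact: measurable_itv.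
- apply: continuous_compact_integrable; first exact: segment_compact.
  apply: continuous_subspaceT => r; apply: (@continuous_comp _ _ _ h (fun t => `|t|)).
    exact: hc.
  exact: norm_continuous.
- apply: continuous_compact_integrable; first exact: segment_compact.
  by apply: continuous_subspaceT => r; exact: cvg_cst.
- move=> r _; apply/ltW/H; by rewrite opprD addrACA subrr addr0.
rewrite Rintegral_cst; last exact: measurable_itv.
have muD : fine (mu D) = 2 * B'.
  have := lebesgue_measure_itv `[- B' - x 0 i, B' - x 0 i]; rewrite /= lte_fin.
  have -> : - B' - x 0 i < B' - x 0 i by lra.
  by move=> /(congr1 fine) /= ->; lra.
change (e' * fine (mu D) < e); rewrite muD /e' mulrAC ltr_pdivrMr// ltr_pM2l//; lra.
Qed.

Definition test_fun T f := unif_cont f /\ supp_bounded T f.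

(** Uniform continuity together with bounded support survives each integration. This makes every
    inner integral integrable along lines, as linearity of the next integral requires. *)
Lemma test_fun_iter_int s T f : uniq s -> (forall i, i \in s -> i \notin T) ->
  test_fun T f -> test_fun (s ++ T) (iter_int s f).
Proof.
elim: s => //= i s IH /andP[ns us] sT tf.
have [|uF [B FB]] := IH us _ tf; first by move=> j js; apply: sT; rewrite inE js orbT.
have iT : i \notin s ++ T by rewrite mem_cat negb_or ns sT// inE eqxx.
split; first by apply: (@line_integral_unif_cont _ _ B) => // y; exact: FB.
exists B => x j; rewrite inE negb_or => /andP[ji jT] xB.
rewrite (_ : (fun r => _) = cst 0); first by rewrite Rintegral_cst// mul0r.
by apply/funext => r; apply: (FB _ j) => //; rewrite coord_dir (negbTE ji) mulr0 addr0.
Qed.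

Lemma iter_int_line_integrable s T f x i : uniq (i :: s) ->
  (forall j, j \in i :: s -> j \notin T) -> test_fun T f ->
  mu.-integrable setT (EFin \o (fun r => iter_int s f (x + r *: dir i))).
Proof.
move=> /= /andP[ns us] sT tf.
have [|uF [B FB]] := test_fun_iter_int us _ tf; first by move=> j js; apply: sT; rewrite inE js orbT.
apply: (@line_integrable _ _ _ B) => // y; apply: FB.
by rewrite mem_cat negb_or ns sT// inE eqxx.
Qed.

Lemma iter_intD s T f g x : uniq s -> (forall i, i \in s -> i \notin T) ->
  test_fun T f -> test_fun T g ->
  iter_int s (fun y => f y + g y) x = iter_int s f x + iter_int s g x.
Proof.
elim: s x => //= i s IH x us sT tf tg.
rewrite -RintegralD//; [|exact: (iter_int_line_integrable _ us sT)..].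
congr (Rintegral _ _ _); apply/funext => r; apply: IH => //; first by case/andP: us.
by move=> j js; apply: sT; rewrite inE js orbT.
Qed.

Lemma iter_intZ s T f (c : R) x : uniq s -> (forall i, i \in s -> i \notin T) ->
  test_fun T f -> iter_int s (fun y => c * f y) x = c * iter_int s f x.
Proof.
elim: s x => //= i s IH x us sT tf.
rewrite -RintegralZl//; last exact: (iter_int_line_integrable _ us sT tf).
congr (Rintegral _ _ _); apply/funext => r; apply: IH => //; first by case/andP: us.
by move=> j js; apply: sT; rewrite inE js orbT.
Qed.

Lemma iter_int_ge0 s f x : (forall y, 0 <= f y) -> 0 <= iter_int s f x.
Proof. by elim: s x => //= i s IH x f0; apply: Rintegral_ge0 => r _; exact: IH. Qed.

Lemma euclid_intD f g : test_fun [::] f -> test_fun [::] g ->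
  euclid_int (fun x => f x + g x) = euclid_int f + euclid_int g.
Proof. by move=> tf tg; apply: (@iter_intD _ [::]) => //; exact: enum_uniq. Qed.

Lemma euclid_intZ f (c : R) : test_fun [::] f ->
  euclid_int (fun x => c * f x) = c * euclid_int f.
Proof. by move=> tf; apply: (@iter_intZ _ [::]) => //; exact: enum_uniq. Qed.

Lemma euclid_int_ge0 f : (forall x, 0 <= f x) -> 0 <= euclid_int f.
Proof. exact: iter_int_ge0. Qed.

Lemma unif_cont_compact_support f (A : set E) : continuous f -> compact A ->
  (forall x, ~ A x -> f x = 0) -> unif_cont f.
Proof.
move=> cf cA fA e e0; have e20 : 0 < e / 2 by rewrite divr_gt0.
(* Heine-Cantor: the modulus d tends to 0 from the right, and compactness turns validity near each
   point into validity on all of [A] for one d. *)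
have /compact_near_coveringP/(_ R (0^'+)
  (fun d x => forall y, `|x - y| < d -> `|f x - f y| < e)) H := cA.
have [|d /= d0 dP] := H _.
- move=> x Ax; have /cvgrPdist_lt/(_ _ e20) := cf x.
  move=> /nbhs_ballP[d /= d0 dP]; exists (ball x (d / 2), [set t | t < d / 2]) => /=.
    split; first by apply: nbhsx_ballx; rewrite divr_gt0.
    by apply: nbhs_right_lt; rewrite divr_gt0.
  move=> [x' t] /= [xx' td] y x'y.
  rewrite -ball_normE /= in xx'.
  have -> : f x' - f y = (f x - f y) - (f x - f x') by ring.
  rewrite (le_lt_trans (ler_normB _ _))// (splitr e) ltrD//; apply: dP; rewrite -ball_normE /=.
    rewrite -(subrK x' x) -addrA (le_lt_trans (ler_normD _ _))//; lra.
  by move: d0 xx'; lra.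
- have d20 : 0 < d / 2 by rewrite divr_gt0.
  have {}dP x y : A x -> `|x - y| < d / 2 -> `|f x - f y| < e.
    move=> Ax; apply: (dP (d / 2)) => //=; rewrite sub0r normrN gtr0_norm//.
    by rewrite ltr_pdivrMr// ltr_pMr// ltr1n.
  exists (d / 2) => // x y xy.
  have [Ax|nAx] := pselect (A x); first exact: dP.
  have [Ay|nAy] := pselect (A y); first by rewrite distrC; apply: dP; rewrite // distrC.
  by rewrite !fA// subrr normr0.
Qed.

End IteratedIntegral.

Lemma near_eq_continuous (T U : topologicalType) (x : T) (f g : T -> U) :
  {near x, f =1 g} -> {for x, continuous g} -> {for x, continuous f}.
Proof.
move=> fg cg; have fgx : f x = g x by exact: (nbhs_singleton fg).
suff : f @ x --> g x by rewrite -fgx.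
apply: cvg_trans cg; apply: near_eq_cvg.
by move: fg; apply: filterS => y /= ->.
Qed.

(** * Linearity and positivity of the integral over M *)

Section ManifoldIntegral.
Context {R : realType} {n : nat} {M : topologicalType} (A : holAtlas R n M).
Hypothesis M_compact : compact [set: M].
Local Notation E := 'rV[R]_(n * 2).
Implicit Types (phi psi : chart A -> E -> R) (q : chart A * (M -> R)).

Definition locally_continuous phi :=
  forall i x, img i x -> {for x, continuous (phi i)}.

Definition chart_integrand phi q : E -> R :=
  (fun x => q.2 (chart_inv q.1 x) * phi q.1 x) \_ (img q.1).

(** Integrates families of chart functions instead of forms; with the partition of unity fixed,
    linearity and positivity can be checked chart by chart. *)
Definition density_int phi : R :=
  \sum_(q <- partition_of_unity A) euclid_int (chart_integrand phi q).

Definition bump q := [/\ fun_smooth A q.2, forall p, 0 <= q.2 p &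
  closure [set p | q.2 p != 0] `<=` dom q.1].

(** In the default case the partition is the empty list, and the property is vacuous. *)
Lemma partition_of_unity_bump : all (fun q => `[< bump q >]) (partition_of_unity A).
Proof.
rewrite /partition_of_unity; case: pselect => //= e.
by case: (cid e) => P /= [].
Qed.

Lemma img_nbhs (i : chart A) x : img i x -> nbhs x (img i).
Proof. by move=> xi; apply: open_nbhs_nbhs; split=> //; exact: img_open. Qed.

(** The support of the bump function is compact in M and contained in the chart, so its image [K] is
    compact in the open set [img]. Extension by zero is continuous because the points outside [img]
    lie in the open complement of [K]. *)
Lemma chart_integrand_test_fun phi q : bump q -> locally_continuous phi ->
  test_fun [::] (chart_integrand phi q).
Proof.
case: q => i b [/= sb b0 cb] cphi.
pose K := chart_map i @` closure [set p | b p != 0].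
have cK : compact K.
  apply: continuous_compact.
    apply: continuous_in_subspaceT => p; rewrite inE => /cb dp.
    exact: chart_map_continuous.
  by apply: (subclosed_compact (@closed_closure _ _) M_compact).
have clK : closed K by apply: compact_closed => //; exact: norm_hausdorff.
have out x : ~ K x -> chart_integrand phi (i, b) x = 0.
  move=> nK; rewrite /chart_integrand patchE; case: ifPn => //; rewrite inE => -[p dp px] /=.
  have [->|bp] := eqVneq (b (chart_inv i x)) 0; first by rewrite mul0r.
  exfalso; apply: nK; exists p => //; apply: subset_closure => /=.
  by move: bp; rewrite -px chart_mapK.
have cF : continuous (chart_integrand phi (i, b)).
  move=> x; have [xi|nxi] := pselect (img i x).
    pose G x := b (chart_inv i x) * phi i x.
    have GF : {near x, chart_integrand phi (i, b) =1 G}.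
      have := img_nbhs xi.
      apply: filterS => y yi; rewrite /chart_integrand patchE /=.
      by rewrite mem_set.
    have Gx : {for x, continuous G}.
      apply: continuousM; last exact: cphi.
      by have [+ _] := sb 0%N i; apply.
    exact: near_eq_continuous GF Gx.
  have nK y : K y -> img i y by move=> [p /cb dp <-]; exists p.
  have xK : ~ K x by move=> /nK.
  apply: (@near_eq_continuous _ _ _ _ (cst 0)); last exact: cst_continuous.
  have := open_nbhs_nbhs (conj (closed_openC clK) xK).
  by apply: filterS => y /out ->.
split; first exact: (unif_cont_compact_support cF cK).
have /compact_bounded[B [_ HB]] := cK.
exists (`|B| + 1) => x j _ xB; apply: out => Kx.
have : `|x| <= `|B| + 1.
  by apply: HB Kx; rewrite (le_lt_trans (ler_norm _))// ltrDl.
move=> H; have := le_lt_trans H (lt_le_trans xB (coord_le_norm x j)).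
by rewrite ltxx.
Qed.

Lemma density_intD phi psi : locally_continuous phi -> locally_continuous psi ->
  density_int (fun i x => phi i x + psi i x) = density_int phi + density_int psi.
Proof.
move=> cphi cpsi; rewrite /density_int -big_split /=.
elim: (partition_of_unity A) partition_of_unity_bump => [|q P IH] /=; first by rewrite !big_nil.
move=> /andP[/asboolP bq /IH{}IH]; rewrite !big_cons IH; congr (_ + _).
rewrite -(euclid_intD (chart_integrand_test_fun bq cphi) (chart_integrand_test_fun bq cpsi)).
congr euclid_int; apply/funext => x; rewrite /chart_integrand !patchE.
by case: ifP; rewrite ?mulrDr ?addr0.
Qed.

Lemma density_intZ phi (c : R) : locally_continuous phi ->
  density_int (fun i x => c * phi i x) = c * density_int phi.
Proof.
move=> cphi; rewrite /density_int mulr_sumr.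
elim: (partition_of_unity A) partition_of_unity_bump => [|q P IH] /=; first by rewrite !big_nil.
move=> /andP[/asboolP bq /IH{}IH]; rewrite !big_cons IH; congr (_ + _).
rewrite -(euclid_intZ _ (chart_integrand_test_fun bq cphi)).
congr euclid_int; apply/funext => x; rewrite /chart_integrand !patchE.
by case: ifP; rewrite ?mulr0// mulrCA.
Qed.

Lemma density_int_ge0 phi : (forall i x, img i x -> 0 <= phi i x) -> 0 <= density_int phi.
Proof.
move=> phi0; rewrite /density_int.
elim: (partition_of_unity A) partition_of_unity_bump => [|q P IH] /=; first by rewrite !big_nil.
move=> /andP[/asboolP[_ q0 _] /IH{}IH]; rewrite big_cons addr_ge0//.
apply: euclid_int_ge0 => x; rewrite /chart_integrand patchE; case: ifPn => //.
by rewrite inE => xi; rewrite mulr_ge0 ?q0 ?phi0.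
Qed.

Lemma eq_density_int phi psi : (forall i x, img i x -> phi i x = psi i x) ->
  density_int phi = density_int psi.
Proof.
move=> E; apply: eq_bigr => q _; congr euclid_int; apply/funext => x.
by rewrite /chart_integrand !patchE; case: ifPn => //; rewrite inE => xi; rewrite E.
Qed.

Lemma manifold_intE (a : local_forms A) :
  manifold_int a = density_int (fun i x => density (a i x)).
Proof. by []. Qed.

Lemma locally_continuousD phi psi : locally_continuous phi -> locally_continuous psi ->
  locally_continuous (fun i x => phi i x + psi i x).
Proof. by move=> cphi cpsi i x xi; apply: continuousD; [exact: cphi|exact: cpsi]. Qed.

Lemma locally_continuousZ phi (c : R) : locally_continuous phi ->
  locally_continuous (fun i x => c * phi i x).
Proof. by move=> cphi i x xi; apply: continuousM; [exact: cst_continuous|exact: cphi]. Qed.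

Lemma locally_continuous0 : locally_continuous (fun _ _ => 0).
Proof. by move=> i x _; exact: cst_continuous. Qed.

Lemma locally_continuous_sum I (r : seq I) (F : I -> chart A -> E -> R) :
  (forall j, locally_continuous (F j)) ->
  locally_continuous (fun i x => \sum_(j <- r) F j i x).
Proof.
move=> cF; elim: r => [|j r IH].
  move=> i x _; have -> : (fun y => \sum_(j <- [::]) F j i y) = cst 0 by apply/funext => y; rewrite big_nil.
  exact: cst_continuous.
move=> i x xi; have -> : (fun y => \sum_(j <- j :: r) F j i y) =
    (fun y => F j i y + \sum_(j <- r) F j i y) by apply/funext => y; rewrite big_cons.
by apply: (locally_continuousD (cF j) IH).
Qed.

Lemma density_int_sum I (r : seq I) (F : I -> chart A -> E -> R) :
  (forall j, locally_continuous (F j)) ->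
  density_int (fun i x => \sum_(j <- r) F j i x) = \sum_(j <- r) density_int (F j).
Proof.
move=> cF; elim: r => [|j r IH].
  rewrite big_nil -[RHS](mul0r (density_int (fun _ _ => 0))) -density_intZ; last exact: locally_continuous0.
  by apply: eq_density_int => i x _; rewrite big_nil mul0r.
rewrite big_cons -IH -density_intD//; last exact: locally_continuous_sum.
by apply: eq_density_int => i x _; rewrite big_cons.
Qed.

End ManifoldIntegral.

(** * Symmetry of second partial derivatives *)

Section MixedPartials.
Context {R : realType} {m : nat}.
Local Notation E := 'rV[R]_m.
Implicit Types (f : E -> R) (U : set E) (x y : E) (i j : 'I_m).

Lemma line_is_derive f (a v : E) (s : R) : derivable f (a + s *: v) v ->
  is_derive s 1 (fun r : R => f (a + r *: v)) ('D_v f (a + s *: v)).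
Proof.
have E : (fun h : R => h^-1 *: ((f \o shift (a + s *: v)) (h *: v) - f (a + s *: v))) =
   (fun h : R => h^-1 *: (((fun r : R => f (a + r *: v)) \o shift s) (h *: 1) - f (a + s *: v))).
  apply/funext => h /=; rewrite /shift /=; congr (_ *: (f _ - _)).
  by rewrite [h%:A]mulr1 scalerDl addrCA.
by move=> df; split; rewrite /derivable /derive -E.
Qed.

Lemma translate_is_derive f (a b v : E) : derivable f (a + b) v ->
  is_derive a v (fun z => f (z + b)) ('D_v f (a + b)).
Proof.
have E : (fun h : R => h^-1 *: ((f \o shift (a + b)) (h *: v) - f (a + b))) =
   (fun h : R => h^-1 *: (((fun z => f (z + b)) \o shift a) (h *: v) - f (a + b))).
  by apply/funext => h /=; rewrite /shift /= addrA.
by move=> df; split; rewrite /derivable /derive -E.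
Qed.

Lemma line_mvt f x i (h : R) : 0 < h ->
  (forall s, 0 <= s <= h -> derivable f (x + s *: dir i) (dir i)) ->
  exists2 s, 0 <= s <= h & f (x + h *: dir i) - f x = 'D_(dir i) f (x + s *: dir i) * h.
Proof.
move=> h0 df; pose g r := f (x + r *: dir i).
have dg s : s \in `[0, h] -> is_derive s 1 g ('D_(dir i) f (x + s *: dir i)).
  by rewrite in_itv => s0h; apply: line_is_derive; exact: df.
have g1 s : s \in `]0, h[ -> is_derive s 1 g ('D_(dir i) f (x + s *: dir i)).
  by move=> /subset_itv_oo_cc; exact: dg.
have g2 : {within `[0, h], continuous g}.
  by apply: derivable_within_continuous => s /dg[].
have [s s0h] := MVT_segment (ltW h0) g1 g2.
by rewrite subr0 /g scale0r addr0 => E; exists s => //; rewrite in_itv in s0h.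
Qed.

Lemma Ck_derivable U k f i x : Ck U k.+1 f -> U x -> derivable f x (dir i).
Proof. by case=> _ /(_ i)[+ _] Ux; apply. Qed.

Lemma Ck_derive U k f i : Ck U k.+1 f -> Ck U k (fun x => 'D_(dir i) f x).
Proof. by case=> _ /(_ i)[]. Qed.

Arguments Ck_derivable [U k f] i [x] _ _.
Arguments Ck_derive [U k f] i _.

Lemma Ck_continuous U k f x : Ck U k f -> U x -> {for x, continuous f}.
Proof. by case: k => [|k] [+ _]; apply. Qed.

Lemma mixed_difference_mvt U f x i j (h : R) : 0 < h -> Ck U 2 f ->
  (forall y, `|x - y| <= 2 * h -> U y) ->
  exists2 y, `|x - y| <= 2 * h &
    f (x + h *: dir i + h *: dir j) - f (x + h *: dir i) - (f (x + h *: dir j) - f x) =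
    'D_(dir j) (fun z => 'D_(dir i) f z) y * h * h.
Proof.
move=> h0 cf xU.
have near_x s t : 0 <= s <= h -> 0 <= t <= h -> `|x - (x + s *: dir i + t *: dir j)| <= 2 * h.
  move=> /andP[s0 sh] /andP[t0 th].
  rewrite -[x + _ + _]addrA opprD addrA subrr add0r normrN (le_trans (ler_normD _ _))//.
  rewrite !normrZ !ger0_norm// mulr2n mulrDl mul1r lerD//.
    by rewrite (le_trans _ sh)// ler_piMr// norm_dir_le.
  by rewrite (le_trans _ th)// ler_piMr// norm_dir_le.
have hh : 0 <= h <= h by rewrite lexx ltW.
have zh : (0 : R) <= 0 <= h by rewrite lexx ltW.
(* The second difference is a first difference in direction i of [F]. The mean value theorem is
   applied to [F] along i, then to the i-derivative of f along j. *)
pose F z := f (z + h *: dir j) - f z.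
have dF s : 0 <= s <= h -> derivable f (x + s *: dir i + h *: dir j) (dir i) /\
    derivable f (x + s *: dir i) (dir i).
  move=> s0h; split; apply: (Ck_derivable i cf); apply: xU; first exact: near_x.
  by have := near_x s 0 s0h zh; rewrite scale0r addr0.
have shiftD s : 0 <= s <= h -> is_derive (x + s *: dir i) (dir i) F
    ('D_(dir i) f (x + s *: dir i + h *: dir j) - 'D_(dir i) f (x + s *: dir i)).
  move=> /dF[d1 d2].
  have H := translate_is_derive d1.
  exact: is_deriveB H (derivableP d2).
have [s s0h Es] := @line_mvt F x i h h0 (fun s s0h => @ex_derive _ _ _ _ _ _ _ (shiftD s s0h)).
have [|t t0h Et] := @line_mvt (fun z => 'D_(dir i) f z) (x + s *: dir i) j h h0.
  by move=> t t0h; apply: (Ck_derivable j (Ck_derive i cf)); apply: xU; exact: near_x.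
exists (x + s *: dir i + t *: dir j); first exact: near_x.
by move: Es; rewrite /F (@derive_val _ _ _ _ _ _ _ (shiftD s s0h)) Et => <-.
Qed.

(** The second difference is symmetric in i and j, so it computes both mixed derivatives at points
    near x; their continuity at x concludes. *)
Lemma mixed_partials U f x i j : open U -> Ck U 2 f -> U x ->
  'D_(dir i) (fun z => 'D_(dir j) f z) x = 'D_(dir j) (fun z => 'D_(dir i) f z) x.
Proof.
move=> oU cf Ux; 
(* Introduced through an equation, so that the derivatives stay folded in the estimates. *)
have [a aE] : exists a : 'I_m -> 'I_m -> E -> R,
  a = fun k l z => 'D_(dir l) (fun z => 'D_(dir k) f z) z by eexists.
suff H (e : R) : 0 < e -> `|a j i x - a i j x| <= e.
  suff : a j i x = a i j x by rewrite aE.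
  apply/eqP; rewrite -subr_eq0 -normr_eq0 eq_le normr_ge0 andbT.
  by apply/ler_addgt0Pl => e e0; rewrite addr0; exact: H.
move=> e0; have e20 : 0 < e / 2 by rewrite divr_gt0.
have ca k l : {for x, continuous (a k l)}.
  by rewrite aE; exact: (Ck_continuous (Ck_derive l (Ck_derive k cf)) Ux).
have /cvgrPdist_lt/(_ _ e20)/nbhs_ballP[d1 /= d10 H1] := ca j i.
have /cvgrPdist_lt/(_ _ e20)/nbhs_ballP[d2 /= d20 H2] := ca i j.
have /nbhs_ballP[d3 /= d30 H3] := open_nbhs_nbhs (conj oU Ux).
pose d := Num.min d1 (Num.min d2 d3); pose h := d / 4.
have d0 : 0 < d by rewrite !lt_min d10 d20.
have h0 : 0 < h by rewrite divr_gt0.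
have small y : `|x - y| <= 2 * h -> `|x - y| < d.
  by move=> /le_lt_trans; apply; rewrite /h; lra.
have inU y : `|x - y| <= 2 * h -> U y.
  by move=> /small xy; apply: H3; rewrite -ball_normE /= (lt_le_trans xy)// !ge_min lexx !orbT.
have [y1 xy1 E1] := mixed_difference_mvt i j h0 cf inU.
have [y2 xy2 E2] := mixed_difference_mvt j i h0 cf inU.
have E : a i j y1 = a j i y2.
  have hn : h != 0 by rewrite gt_eqF.
  apply: (mulIf hn); apply: (mulIf hn); rewrite aE -[LHS]E1 -[RHS]E2.
  by rewrite [x + h *: dir j + _]addrAC; ring.
have B1 : `|a i j x - a i j y1| < e / 2.
  by apply: H2; rewrite -ball_normE /= (lt_le_trans (small _ xy1))// !ge_min lexx !orbT.
have B2 : `|a j i x - a j i y2| < e / 2.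
  by apply: H1; rewrite -ball_normE /= (lt_le_trans (small _ xy2))// !ge_min lexx.
clear E1 E2 ca; have -> : a j i x - a i j x = (a j i x - a j i y2) - (a i j x - a i j y1) by rewrite E; ring.
by rewrite (le_trans (ler_normB _ _))//; lra.
Qed.

End MixedPartials.
Arguments Ck_derivable {R m} [U k f] i [x] _ _.
Arguments Ck_derive {R m} [U k f] i _.

(** * The gradient form and the complex Hessian as matrices *)

Section ComplexHessian.
Context {R : realType} {n : nat}.
Local Notation C := R[i].
Local Notation E := 'rV[R]_(n * 2).
Local Notation L := (extalg R (n * 2)).
Implicit Types (f g : E -> R) (c : E -> C) (x y : E) (U : set E).

Definition second_partial (a b : 'I_(n * 2)) f x : R :=
  'D_(dir a) (fun z => 'D_(dir b) f z) x.
Local Notation d2 := second_partial.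

Lemma second_partialC U f x a b : open U -> Ck U 2 f -> U x -> d2 a b f x = d2 b a f x.
Proof. exact: mixed_partials. Qed.

Lemma complex_ReM (z w : C) : Re (z * w) = Re z * Re w - Im z * Im w.
Proof. by case: z; case: w. Qed.

Lemma complex_ImM (z w : C) : Im (z * w) = Re z * Im w + Im z * Re w.
Proof. by case: z; case: w. Qed.

Lemma complex_half (p q : R) : (p +i* q) / 2%:R = (p / 2) +i* (q / 2) :> C.
Proof.
have -> : 2%:R^-1 = (2^-1)%:C :> C by rewrite fmorphV rmorph_nat.
by apply/eqP; rewrite eq_complex /= !mulr0 subr0 add0r !eqxx.
Qed.

Definition grad_z f x (j : 'I_n) : C :=
  ('D_(dir (xi j)) f x / 2) -i* ('D_(dir (yi j)) f x / 2).

Lemma pderiv_real f (k : 'I_(n * 2)) x :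
  pderiv k (fun y => (f y)%:C) x = ('D_(dir k) f x)%:C.
Proof. by rewrite /pderiv; congr (_ +i* _); exact: derive_cst. Qed.

Lemma pderiv_z_real f j x : pderiv_z j (fun y => (f y)%:C) x = grad_z f x j.
Proof.
rewrite /pderiv_z !pderiv_real /grad_z -[- (_ / 2)]mulNr -complex_half; congr (_ / _).
by apply/eqP; rewrite eq_complex /= !mul0r !mulr0 mul1r !subr0 !add0r !eqxx.
Qed.

Lemma pderiv_zbar_real f j x :
  pderiv_zbar j (fun y => (f y)%:C) x = conjc (grad_z f x j).
Proof.
rewrite /pderiv_zbar !pderiv_real /grad_z /= opprK -complex_half; congr (_ / _).
by apply/eqP; rewrite eq_complex /= !mul0r !mulr0 mul1r !subr0 !addr0 !add0r !eqxx.
Qed.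

Lemma form_of_fun_coef f (S : {set 'I_(n * 2)}) :
  (fun y => form_of_fun f y S) =
  if S == finset.set0 then (fun y => (f y)%:C) else (fun y => (0 : R)%:C).
Proof. by apply/funext => y; rewrite ffunE; case: ifP. Qed.

Lemma grad_z0 j x : grad_z (fun=> 0) x j = 0.
Proof. by rewrite /grad_z !derive_cst !mul0r oppr0. Qed.

Lemma del_fun f x : del (form_of_fun f) x = \sum_j escale (grad_z f x j) (dz j).
Proof.
apply: eq_bigr => j _; rewrite -wedge_constr; congr wedge; apply/ffunP => S.
rewrite !ffunE form_of_fun_coef; case: (S == _); first by rewrite pderiv_z_real.
by rewrite pderiv_z_real grad_z0.
Qed.

Lemma delbar_fun f x :
  delbar (form_of_fun f) x = \sum_j escale (conjc (grad_z f x j)) (dzbar j).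
Proof.
apply: eq_bigr => j _; rewrite -wedge_constr; congr wedge; apply/ffunP => S.
rewrite !ffunE form_of_fun_coef; case: (S == _); first by rewrite pderiv_zbar_real.
by rewrite pderiv_zbar_real grad_z0 conjc0.
Qed.

(** The factor 2 cancels the denominator in the i/2 of [form11]. *)
Definition grad_mx f x : 'M[C]_n :=
  \matrix_(j, l) (2%:R * grad_z f x j * conjc (grad_z f x l)).

Lemma grad_mx_hermitian f x : hermitian_mx (grad_mx f x).
Proof.
move=> j l; rewrite !mxE.
have E a b : conjc (2%:R * a * conjc b) = 2%:R * conjc a * b :> C.
  by rewrite !rmorphM rmorph_nat /= conjcK.
by rewrite E [RHS]mulrAC.
Qed.

Lemma grad_mx_ge0 f x v : 0 <= quad_form (grad_mx f x) v.
Proof.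
have -> : quad_form (grad_mx f x) v =
   2%:R * ((\sum_j v j * grad_z f x j) * conjc (\sum_j v j * grad_z f x j)).
  rewrite rmorph_sum mulr_suml mulr_sumr; apply: eq_bigr => j _.
  rewrite mulr_sumr mulr_sumr; apply: eq_bigr => l _.
  by rewrite mxE rmorphM /=; ring.
by rewrite mulr_ge0// mulcJ_ge0.
Qed.

Lemma gradient_form f x :
  escale 'i (wedge (del (form_of_fun f) x) (delbar (form_of_fun f) x)) =
  form11 (grad_mx f x).
Proof.
rewrite del_fun delbar_fun wedge_suml escale_sum /form11 escale_sum.
apply: eq_bigr => j _; rewrite wedge_sumr !escale_sum; apply: eq_bigr => l _.
rewrite wedgeZl wedgeZr !escaleA mxE; congr escale.
by rewrite !mulrA divfK// pnatr_eq0.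
Qed.

(** The matrix of the derivatives d^2 f / dz_j dzbar_l, written in real second partials so that
    Hermitian symmetry reduces to [mixed_partials]. *)
Definition hessian_mx f x : 'M[C]_n := \matrix_(j, l)
  (((d2 (xi j) (xi l) f x + d2 (yi j) (yi l) f x) / 4) +i*
   ((d2 (xi j) (yi l) f x - d2 (yi j) (xi l) f x) / 4)).

Lemma hessian_hermitian U f x : open U -> Ck U 2 f -> U x ->
  hermitian_mx (hessian_mx f x).
Proof.
move=> oU cf Ux j l; rewrite !mxE /=.
rewrite (second_partialC (xi l) (xi j) oU cf Ux) (second_partialC (yi l) (yi j) oU cf Ux).
rewrite (second_partialC (xi l) (yi j) oU cf Ux) (second_partialC (yi l) (xi j) oU cf Ux).
by rewrite -mulNr opprB.
Qed.

(** Built on [is_derive], which includes existence; the bare value of [pderiv] would not be additive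
    at points where a derivative fails to exist. *)
Definition is_cderive (k : 'I_(n * 2)) x c (z : C) :=
  is_derive x (dir k) (fun y => Re (c y)) (Re z) /\
  is_derive x (dir k) (fun y => Im (c y)) (Im z).

Lemma is_cderive_pderiv k x c z : is_cderive k x c z -> pderiv k c x = z.
Proof. by case: z => a b [[_ d1] [_ d2']]; rewrite /pderiv d1 d2'. Qed.

Lemma is_derive_mulr x (v : E) f (a r : R) : is_derive x v f r ->
  is_derive x v (fun y => f y * a) (r * a).
Proof.
move=> df; have := is_deriveZ a df; rewrite [a *: r]mulrC.
by congr (is_derive _ _ _ _); apply/funext => y; rewrite /= [_ *: _]mulrC.
Qed.

Lemma is_cderiveM k x c z w : is_cderive k x c z -> is_cderive k x (fun y => c y * w) (z * w).
Proof.
case: z w => a b [p q] [d1 d3]; split => /=.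
  have -> : (fun y => Re (c y * (p +i* q))) = (fun y => Re (c y) * p) - (fun y => Im (c y) * q).
    by apply/funext => y; exact: complex_ReM.
  exact: is_deriveB (is_derive_mulr p d1) (is_derive_mulr q d3).
have -> : (fun y => Im (c y * (p +i* q))) = (fun y => Re (c y) * q) + (fun y => Im (c y) * p).
  by apply/funext => y; exact: complex_ImM.
exact: is_deriveD (is_derive_mulr q d1) (is_derive_mulr p d3).
Qed.

Lemma is_cderive_sum k x I (r : seq I) (c : I -> E -> C) (z : I -> C) :
  (forall l, is_cderive k x (c l) (z l)) ->
  is_cderive k x (fun y => \sum_(l <- r) c l y) (\sum_(l <- r) z l).
Proof.
move=> dc; elim: r => [|l r [IH1 IH2]].
  rewrite big_nil; split.
    have -> : (fun y => Re (\sum_(l <- [::]) c l y)) = cst 0.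
      by apply/funext => y; rewrite big_nil.
    exact: is_derive_cst.
  have -> : (fun y => Im (\sum_(l <- [::]) c l y)) = cst 0.
    by apply/funext => y; rewrite big_nil.
  exact: is_derive_cst.
rewrite big_cons; have [d1 d3] := dc l; split.
  have -> : (fun y => Re (\sum_(l <- l :: r) c l y)) =
      (fun y => Re (c l y)) + (fun y => Re (\sum_(l <- r) c l y)).
    by apply/funext => y; rewrite big_cons ReD.
  by rewrite ReD; exact: is_deriveD.
have -> : (fun y => Im (\sum_(l <- l :: r) c l y)) =
    (fun y => Im (c l y)) + (fun y => Im (\sum_(l <- r) c l y)).
  by apply/funext => y; rewrite big_cons ImD.
by rewrite ImD; exact: is_deriveD.
Qed.

Lemma is_cderive_grad U f x (k : 'I_(n * 2)) l : Ck U 2 f -> U x ->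
  is_cderive k x (fun y => conjc (grad_z f y l))
    ((d2 k (xi l) f x / 2) +i* (d2 k (yi l) f x / 2)).
Proof.
move=> cf Ux; rewrite /grad_z; split => /=.
  by apply: is_derive_mulr; apply: derivableP; exact: (Ck_derivable k (Ck_derive (xi l) cf) Ux).
under eq_fun do rewrite opprK.
by apply: is_derive_mulr; apply: derivableP; exact: (Ck_derivable k (Ck_derive (yi l) cf) Ux).
Qed.

Lemma ddbar_fun U f x : Ck U 2 f -> U x ->
  escale ('i / 2%:R) (del (delbar (form_of_fun f)) x) = form11 (hessian_mx f x).
Proof.
move=> cf Ux; rewrite /form11; congr escale; apply: eq_bigr => j _.
under [RHS]eq_bigr do rewrite -wedgeZr.
rewrite -wedge_sumr; congr wedge; apply/ffunP => S; rewrite ffunE.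
have -> : (fun y => delbar (form_of_fun f) y S) =
    (fun y => \sum_l conjc (grad_z f y l) * dzbar l S).
  by apply/funext => y; rewrite delbar_fun sum_ffunE; apply: eq_bigr => l _; rewrite ffunE.
have D k : pderiv k (fun y => \sum_l conjc (grad_z f y l) * dzbar l S) x =
    \sum_l ((d2 k (xi l) f x / 2) +i* (d2 k (yi l) f x / 2)) * dzbar l S.
  apply: is_cderive_pderiv; apply: is_cderive_sum => l; apply: is_cderiveM.
  exact: is_cderive_grad cf Ux.
rewrite /pderiv_z !D sum_ffunE mulr_sumr -sumrB mulr_suml; apply: eq_bigr => l _.
rewrite [RHS]ffunE mxE [X in _ - X]mulrA -mulrBl mulrAC; congr (_ * _).
set a := d2 _ _ _ _; set b := d2 _ _ _ _; set p := d2 _ _ _ _; set q := d2 _ _ _ _.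
have -> : ((a / 2) +i* (b / 2)) - 'i * ((p / 2) +i* (q / 2)) =
   ((a + q) / 2) +i* ((b - p) / 2) :> C.
  by apply/eqP; rewrite eq_complex /=; apply/andP; split; apply/eqP; field.
by rewrite complex_half; apply/eqP; rewrite eq_complex /=; apply/andP; split; apply/eqP; field.
Qed.

(** Also true where f is not derivable: for t != 0 neither function is, and both derivatives take
    the default value 0. Being unconditional, it gives equalities of functions, so derivatives can
    be iterated. *)
Lemma derive_scale f (t : R) (v : E) x :
  'D_v (fun y => t * f y) x = t * 'D_v f x.
Proof.
have [df|ndf] := pselect (derivable f x v); first exact: deriveZ.
have [->|t0] := eqVneq t 0.
  have -> : (fun y => 0 * f y) = cst 0 by apply/funext => y; rewrite mul0r.
  by rewrite derive_cst mul0r.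
have ndtf : ~ derivable (fun y => t * f y) x v.
  move=> d; apply: ndf.
  have <- : (fun y => t^-1 * (t * f y)) = f by apply/funext => y; rewrite mulKf.
  exact: derivableZ d.
have D0 (h : E -> R) : ~ derivable h x v -> 'D_v h x = 0 by move=> nd; exact: dvgP nd.
by rewrite (D0 _ ndtf) (D0 _ ndf) mulr0.
Qed.

Lemma Ck_scale U f (t : R) k : Ck U k f -> Ck U k (fun y => t * f y).
Proof.
have c0 j (h : E -> R) : Ck U j h -> forall x, U x -> {for x, continuous (fun y => t * h y)}.
  by move=> ch x Ux; apply: continuousM; [exact: cst_continuous|exact: (Ck_continuous ch)].
elim: k f => [|k IH] f cf; split; try exact: (c0 _ _ cf); first by [].
move=> i; split; first by move=> x Ux; apply: derivableZ; exact: (Ck_derivable i cf Ux).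
have -> : (fun x => 'D_(dir i) (fun y => t * f y) x) = (fun x => t * 'D_(dir i) f x).
  by apply/funext => x; rewrite derive_scale.
exact: IH (Ck_derive i cf).
Qed.

Lemma hessian_scale f (t : R) x :
  hessian_mx (fun y => t * f y) x = t%:C *: hessian_mx f x.
Proof.
have D a b : d2 a b (fun y => t * f y) x = t * d2 a b f x.
  rewrite /second_partial.
  have -> : (fun z => 'D_(dir b) (fun y => t * f y) z) = (fun z => t * 'D_(dir b) f z).
    by apply/funext => z; rewrite derive_scale.
  by rewrite derive_scale.
apply/matrixP => j l; rewrite !mxE !D.
set a := d2 _ _ _ _; set b := d2 _ _ _ _; set p := d2 _ _ _ _; set q := d2 _ _ _ _.
by apply/eqP; rewrite eq_complex /=; apply/andP; split; apply/eqP; field.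
Qed.

End ComplexHessian.

(** * Continuity of forms in a chart *)

Section FormContinuity.
Context {R : realType} {m : nat}.
Local Notation C := R[i].
Local Notation E := 'rV[R]_m.
Local Notation L := (extalg R m).
Implicit Types (c d : E -> C) (a b : E -> L) (x : E).

Lemma eq_continuous_for (f g : E -> R) x : f =1 g -> {for x, continuous f} -> {for x, continuous g}.
Proof. by move=> /funext ->. Qed.

Definition ccont x c :=
  {for x, continuous (fun y => Re (c y))} /\ {for x, continuous (fun y => Im (c y))}.

Lemma eq_ccont x c d : c =1 d -> ccont x c -> ccont x d.
Proof. by move=> /funext ->. Qed.

Lemma ccont_cst x (z : C) : ccont x (fun=> z).
Proof. by split; exact: cst_continuous. Qed.

Lemma ccontD x c d : ccont x c -> ccont x d -> ccont x (fun y => c y + d y).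
Proof.
move=> [c1 c2] [d1 d2]; split.
  by apply: eq_continuous_for (continuousD c1 d1) => y; rewrite ReD.
by apply: eq_continuous_for (continuousD c2 d2) => y; rewrite ImD.
Qed.

Lemma ccontM x c d : ccont x c -> ccont x d -> ccont x (fun y => c y * d y).
Proof.
move=> [c1 c2] [d1 d2]; split.
  apply: eq_continuous_for (continuousB (continuousM c1 d1) (continuousM c2 d2)) => y.
  by rewrite [RHS]complex_ReM.
apply: eq_continuous_for (continuousD (continuousM c1 d2) (continuousM c2 d1)) => y.
by rewrite [RHS]complex_ImM.
Qed.

Lemma ccont_sum x I (r : seq I) (P : pred I) (c : I -> E -> C) :
  (forall i, ccont x (c i)) -> ccont x (fun y => \sum_(i <- r | P i) c i y).
Proof.
move=> cc; elim: r => [|i r IH].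
  by apply: eq_ccont (ccont_cst x 0) => y; rewrite big_nil.
have [Pi|Pi] := boolP (P i); last by apply: eq_ccont IH => y; rewrite big_cons (negbTE Pi).
by apply: eq_ccont (ccontD (cc i) IH) => y; rewrite big_cons Pi.
Qed.

Lemma ccont_conj x c : ccont x c -> ccont x (fun y => conjc (c y)).
Proof.
move=> [c1 c2]; split; first by apply: eq_continuous_for c1 => y; case: (c y).
by apply: eq_continuous_for (continuousN c2) => y; rewrite /=; case: (c y).
Qed.

Definition fcont x a := forall S, ccont x (fun y => a y S).

Lemma fcont_cst x (z : L) : fcont x (fun=> z).
Proof. by move=> S; exact: ccont_cst. Qed.

Lemma fcontM x a b : fcont x a -> fcont x b -> fcont x (fun y => wedge (a y) (b y)).
Proof.
move=> ca cb S.
apply: (@eq_ccont _ (fun y => \sum_(A : {set 'I_m} | A \subset S)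
  (-1) ^+ inversions A (S :\: A) * a y A * b y (S :\: A)%SET)).
  by move=> y; rewrite ffunE.
apply: ccont_sum => A; apply: ccontM; last exact: cb.
apply: ccontM; [exact: ccont_cst|exact: ca].
Qed.

Lemma fcontZ x c a : ccont x c -> fcont x a -> fcont x (fun y => escale (c y) (a y)).
Proof. by move=> cc ca S; apply: eq_ccont (ccontM cc (ca S)) => y; rewrite ffunE. Qed.

Lemma fcont_exp x a k : fcont x a -> fcont x (fun y => wedge_exp (a y) k).
Proof.
move=> ca; elim: k => [|k IH]; first exact: fcont_cst.
exact: (fcontM ca IH).
Qed.

Lemma fcont_sum x I (r : seq I) (P : pred I) (a : I -> E -> L) :
  (forall i, fcont x (a i)) -> fcont x (fun y => \sum_(i <- r | P i) a i y).
Proof.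
move=> ca S; apply: (@eq_ccont _ (fun y => \sum_(i <- r | P i) a i y S)).
  by move=> y; rewrite sum_ffunE.
by apply: ccont_sum => i; exact: ca.
Qed.

Lemma fcont_density x a : fcont x a -> {for x, continuous (fun y => density (a y))}.
Proof. by move=> /(_ [set: 'I_m]%SET)[]. Qed.

Lemma smooth_form_fcont (U : set E) a x : smooth_form_on U a -> U x -> fcont x a.
Proof.
move=> sa Ux S; have [s1 s2] := sa S.
by split; [exact: (Ck_continuous (s1 0%N) Ux)|exact: (Ck_continuous (s2 0%N) Ux)].
Qed.

End FormContinuity.

Section MatrixFormContinuity.
Context {R : realType} {n : nat}.
Local Notation C := R[i].
Local Notation E := 'rV[R]_(n * 2).
Implicit Types (f : E -> R) (x : E) (U : set E).

Lemma fcont_form11 x (h : E -> 'M[C]_n) : (forall j l, ccont x (fun y => h y j l)) ->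
  fcont x (fun y => form11 (h y)).
Proof.
move=> ch; apply: fcontZ; first exact: ccont_cst.
apply: fcont_sum => j; apply: fcont_sum => l; apply: fcontZ; first exact: ch.
exact: fcont_cst.
Qed.

Lemma continuous_divr (g : E -> R) (r : R) x : {for x, continuous g} ->
  {for x, continuous (fun y => g y / r)}.
Proof. by move=> cg; apply: continuousM => //; exact: cst_continuous. Qed.

Lemma fcont_hessian U f x : Ck U 2 f -> U x -> fcont x (fun y => form11 (hessian_mx f y)).
Proof.
move=> cf Ux; apply: fcont_form11 => j l.
have D a b : {for x, continuous (second_partial a b f)}.
  exact: (Ck_continuous (Ck_derive a (Ck_derive b cf)) Ux).
apply: (@eq_ccont _ _ _ (fun y => ((second_partial (xi j) (xi l) f y + second_partial (yi j) (yi l) f y) / 4) +i*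
   ((second_partial (xi j) (yi l) f y - second_partial (yi j) (xi l) f y) / 4))).
  by move=> y; rewrite mxE.
by split => /=; apply: continuous_divr; [apply: continuousD|apply: continuousB].
Qed.

Lemma fcont_grad U f x : Ck U 2 f -> U x -> fcont x (fun y => form11 (grad_mx f y)).
Proof.
move=> cf Ux; apply: fcont_form11 => j l.
have D a : {for x, continuous (fun x => 'D_(dir a) f x)}.
  exact: (Ck_continuous (Ck_derive a cf) Ux).
have G k : ccont x (fun y => grad_z f y k).
  by split => /=; [|apply: continuousN]; apply: continuous_divr.
apply: (@eq_ccont _ _ _ (fun y => 2%:R * grad_z f y j * conjc (grad_z f y l))).
  by move=> y; rewrite mxE.
apply: ccontM; last exact: ccont_conj.
by apply: ccontM => //; exact: ccont_cst.
Qed.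

End MatrixFormContinuity.

(** * The cone Gamma_m at a point: mixed positivity and convexity *)

Section Cone.
Context {R : realType} {n : nat}.
Local Notation C := R[i].
Local Notation K := (even_ext R (n * 2)).
Local Notation io := (@even_const R (n * 2)).
Variable g : 'M[C]_n.
Hypothesis g_hermitian : hermitian_mx g.
Hypothesis g_posdef : posdef_mx g.
Implicit Types (a b : K) (m : nat).

(** The pointwise content of [Gamma], with the case j = 0 added and the positive normalising factors
    of [sigma] removed. *)
Definition gamma_cone m a := hermitian_form a /\
  forall j, (j <= m)%N -> 0 < top_coef (a ^+ j * hform g ^+ (n - j)).

Lemma gamma_coneS m m' a : (m' <= m)%N -> gamma_cone m a -> gamma_cone m' a.
Proof. by move=> mm' [ha ca]; split=> // j jm; apply: ca; exact: leq_trans mm'. Qed.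

Lemma prod_nseq a k : \prod_(c <- nseq k a) c = a ^+ k.
Proof. by rewrite big_nseq iter_mulr_1. Qed.

Lemma gamma_cone_mixed m a b j k : (m <= n)%N -> (j + k <= m)%N ->
  gamma_cone m a -> gamma_cone m b ->
  0 < top_coef (a ^+ j * b ^+ k * hform g ^+ (n - (j + k))).
Proof.
move=> mn jkm ca cb.
have Hg : hermitian_form (hform g) by exists g.
have := garding hermitian_formD hermitian_formZ top_coef_linear (hform_hyperbolic g_posdef) Hg.
move=> /(_ (nseq j a ++ nseq k b)); rewrite size_cat !size_nseq big_cat /= !prod_nseq.
apply; first exact: leq_trans mn.
move=> c; rewrite mem_cat => /orP[] /nseqP[-> _].
  by case: (gamma_coneS jkm ca).
by case: (gamma_coneS jkm cb).
Qed.

(** Expand the power by the binomial theorem: all mixed terms are positive by Garding's inequality,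
    and s > 0 keeps the pure power of a strictly positive. *)
Lemma gamma_cone_comb m a b (s t : R) : (m <= n)%N -> 0 < s -> 0 <= t ->
  gamma_cone m a -> gamma_cone m b -> gamma_cone m (io s%:C * a + io t%:C * b).
Proof.
move=> mn s0 t0 ca cb; split.
  by apply: hermitian_formD; apply: hermitian_formZ; [exact: ca.1|exact: cb.1].
have s0' : 0 < s%:C by rewrite -[0]/(0%:C) ltcR.
have t0' : 0 <= t%:C by rewrite -[0]/(0%:C) lecR.
move=> j jm; rewrite exprDn mulr_suml (linear_form_sum _ _ _ top_coef_linear).
have F (i : 'I_j.+1) : top_coef ((io s%:C * a) ^+ (j - i) * (io t%:C * b) ^+ i *+ 'C(j, i) *
    hform g ^+ (n - j)) = (s%:C ^+ (j - i) * t%:C ^+ i) *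
    top_coef (a ^+ (j - i) * b ^+ i * hform g ^+ (n - (j - i + i))) *+ 'C(j, i).
  rewrite mulrnAl (linear_formMn _ _ top_coef_linear) subnK; last by rewrite -ltnS.
  have ioX (z : C) (x : K) k : (io z * x) ^+ k = io (z ^+ k) * x ^+ k.
    by rewrite exprMn rmorphXn.
  have ioM (z z' : C) : io z * io z' = io (z * z') by rewrite rmorphM.
  by rewrite !ioX mulrACA ioM -[io _ * _ * hform g ^+ _]mulrA top_coef_linear.2.
rewrite big_ord_recl ltr_wpDr//.
  apply: sumr_ge0 => i _; rewrite F; apply: mulrn_wge0; apply: mulr_ge0.
    by apply: mulr_ge0; apply: exprn_ge0 => //; exact: ltW.
  apply: ltW; apply: (gamma_cone_mixed mn _ ca cb); rewrite subnK//.
  by rewrite -ltnS.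
rewrite F /= bin0 mulr1n expr0 mulr1; apply: mulr_gt0; first exact: exprn_gt0.
by apply: (gamma_cone_mixed mn _ ca cb); rewrite subn0 addn0.
Qed.

Lemma gamma_cone_ge0 (p : 'M[C]_n) N m a b : hermitian_mx p ->
  (forall v, 0 <= quad_form p v) -> (m < n)%N -> (N.+2 <= m)%N ->
  gamma_cone m a -> gamma_cone m b ->
  0 <= top_coef (hform p * (a ^+ N * b) * hform g ^+ (n - N.+2)).
Proof.
move=> hp p0 mn Nm ca cb.
have := @hform_mixed_ge0 _ _ g p (b :: nseq N a) g_hermitian g_posdef hp p0.
rewrite big_cons prod_nseq /= size_nseq [a ^+ N * b]mulrC.
apply; first by apply: leq_trans mn; rewrite ltnW.
move=> c; rewrite inE => /orP[/eqP ->|/nseqP[-> _]].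
  by case: (gamma_coneS Nm cb).
by case: (gamma_coneS Nm ca).
Qed.

End Cone.

(** * Moment polynomials in t and their integrals over [0, 1/2] *)

Section PolynomialIntegral.
Context {R : realType}.
Local Notation mu := (@lebesgue_measure R).
Implicit Types P Q : {poly R}.

Definition poly_int P : R := \int[mu]_(t in `[0%R, 2^-1]%classic) P.[t].

Lemma poly_integrable P :
  mu.-integrable `[0%R, 2^-1]%classic (EFin \o (fun t => P.[t])).
Proof.
apply: continuous_compact_integrable; first exact: segment_compact.
exact/continuous_subspaceT/continuous_horner.
Qed.

Lemma poly_intD P Q : poly_int (P + Q) = poly_int P + poly_int Q.
Proof.
rewrite /poly_int -RintegralD//; [|exact: poly_integrable..].
by apply: eq_Rintegral => t _; rewrite hornerD.
Qed.

Lemma poly_intZ (c : R) P : poly_int (c *: P) = c * poly_int P.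
Proof.
rewrite /poly_int -RintegralZl//; last exact: poly_integrable.
by apply: eq_Rintegral => t _; rewrite hornerZ.
Qed.

Lemma poly_intN P : poly_int (- P) = - poly_int P.
Proof. by rewrite -scaleN1r poly_intZ mulN1r. Qed.

Lemma poly_int_ge0 P : (forall t, 0 <= t <= 2^-1 -> 0 <= P.[t]) -> 0 <= poly_int P.
Proof.
by move=> P0; apply: Rintegral_ge0 => t /=; rewrite in_itv /=; exact: P0.
Qed.

Lemma poly_int_deriv P : poly_int P^`()%R = P.[2^-1] - P.[0].
Proof.
rewrite /poly_int /Rintegral (@continuous_FTC2 _ _ (horner P))//.
- exact/continuous_subspaceT/continuous_horner.
- split; first by move=> x _; exact: derivable_horner.
    by apply: cvg_at_right_filter; exact: continuous_horner.
  by apply: cvg_at_left_filter; exact: continuous_horner.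
- by move=> x _; rewrite derivE.
Qed.

(* The moment polynomials of a bilinear array c, where c a b stands for the
   integral of a form of degree a in chi0 and b in the Hessian. *)
Definition moment_poly (c : nat -> nat -> R) N : {poly R} :=
  \poly_(r < N.+1) (c (N - r)%N r *+ 'C(N, r)).

(** The derivative of t X_t^(N+1), read off coefficient by coefficient. In [Q] one factor chi0 has
    been replaced by chi0 - tau w, which is the role of B. *)
Lemma moment_poly_deriv c (tau : R) N (Q : {poly R}) :
  Q = \poly_(r < N.+1) ((c (N.+1 - r)%N r - tau * c (N - r)%N r) *+ 'C(N, r)) ->
  ('X * moment_poly c N.+1)^`()%R =
  N.+2%:R *: moment_poly c N.+1 - (N.+1%:R * tau) *: moment_poly c N - N.+1%:R *: Q.
Proof.
move=> ->; apply/polyP => r; rewrite coef_deriv coefXM /= !coefB !coefZ !coef_poly.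
(* Beyond degree N + 1 everything vanishes, and in degree N + 1 itself only the first term on the
   right contributes. *)
case: (ltnP r N.+2) => [rN|rN]; last first.
  by rewrite ltnNge (ltnW rN) /= mul0rn !mulr0 !subr0.
move: rN; rewrite ltnS leq_eqVlt => /predU1P[->|rN].
  by rewrite ltnn !mulr0 !subr0 binn mulr1n mulr_natl.
rewrite rN; have rN' : (r <= N.+1)%N by exact: ltnW.
have E : N.+1%:R * 'C(N, r)%:R = (N.+1%:R - r%:R) * 'C(N.+1, r)%:R :> R.
  by rewrite -natrB// -!natrM; congr _%:R; exact: (mul_bin_down N.+1 r).
have Er : r.+1%:R = r%:R + 1 :> R by rewrite -natr1.
set A := c _ r; set B := c (N - r)%N r.
have -> : A *+ 'C(N.+1, r) *+ r.+1 = A * 'C(N.+1, r)%:R * (r%:R + 1).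
  by rewrite -Er !mulr_natr.
have -> : N.+2%:R * (A *+ 'C(N.+1, r)) = (N.+1%:R + 1) * (A * 'C(N.+1, r)%:R).
  by rewrite natr1 mulr_natr.
rewrite -(mulr_natr B) -(mulr_natr (A - tau * B)).
transitivity ((N.+1%:R + 1) * (A * 'C(N.+1, r)%:R) - A * (N.+1%:R * 'C(N, r)%:R)).
  by rewrite E; ring.
by ring.
Qed.

Lemma moment_poly_ineq c (tau : R) N :
  (forall t, 0 <= t <= 2^-1 ->
    0 <= (\poly_(r < N.+1) ((c (N.+1 - r)%N r - tau * c (N - r)%N r) *+ 'C(N, r))).[t]) ->
  0 <= (moment_poly c N.+1).[2^-1] ->
  tau * (N.+1%:R * poly_int (moment_poly c N)) <= N.+2%:R * poly_int (moment_poly c N.+1).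
Proof.
set Q := \poly_(r < N.+1) _ => Q0 J0.
have /(congr1 poly_int) := @moment_poly_deriv c tau N Q erefl.
rewrite poly_int_deriv !hornerM !hornerX mul0r subr0.
rewrite !poly_intD !poly_intN !poly_intZ => E.
have := poly_int_ge0 Q0; rewrite -(pmulr_rge0 _ (ltr0n R N.+1)) => Q1.
have : 0 <= 2^-1 * (moment_poly c N.+1).[2^-1] by rewrite mulr_ge0.
by rewrite E; move: Q1; lra.
Qed.

End PolynomialIntegral.

(** * From the pointwise cones to the one-step integral inequality *)

Section Main.
Context {R : realType} {n : nat} {M : topologicalType} (A : holAtlas R n M).
Local Notation C := R[i].
Local Notation E := 'rV[R]_(n * 2).
Local Notation K := (even_ext R (n * 2)).
Local Notation io := (@even_const R (n * 2)).
Variables (w chi0 : local_forms A) (k : nat) (tau : R) (u : M -> R) (p : R).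
Hypothesis M_compact : compact [set: M].
Hypothesis w_kahler : kahler_form w.
Hypothesis k_bounds : (2 <= k <= n)%N.
Hypothesis chi0_form : smooth_real11_form chi0.
Hypothesis chi0_Gamma : Gamma w k.-1 chi0.
Hypothesis chi0_lower :
  Gamma w k.-1 (fun i x => chi0 i x - escale (tau%:C)%C (w i x)).
Hypothesis u_C2 : funCk A 2 u.
Hypothesis chi_u_Gamma : Gamma w k.-1 (chi_ chi0 u).

Lemma real11_hermitian_form (a : extalg R (n * 2)) : real11 a ->
  exists2 h : 'M[C]_n, hermitian_mx h & a = even_val (hform h).
Proof.
move=> [[h ah] a_real].
have rh : real_form (hform h).
  rewrite /real_form even_val_hform -ah; apply/ffunP => S; rewrite ffunE.
  by have := a_real S; case: (a S) => x y /= ->; rewrite oppr0.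
have [g [hg gh _]] := hermitian_part rh.
by exists g; rewrite // gh even_val_hform.
Qed.

Lemma kahler_matrix i x : img i x ->
  exists g : 'M[C]_n, [/\ hermitian_mx g, posdef_mx g & w i x = even_val (hform g)].
Proof.
have [[_ _ w_real] w_pos _] := w_kahler.
move=> xi; have [g wg g_pos] := w_pos i x xi.
have [_ re] := w_real i x xi.
have rg : real_form (hform g).
  rewrite /real_form even_val_hform -wg; apply/ffunP => S; rewrite ffunE.
  by have := re S; case: (w i x S) => a b /= ->; rewrite oppr0.
have gP v : (exists j, v j != 0) -> 0 < quad_form g v by exact: g_pos.
have [h [hh hg hq]] := hermitian_part rg; exists h; split => //.
  by move=> v v0; rewrite (hq v (gP v v0)) gP.
by rewrite hg even_val_hform.
Qed.

Lemma density_even (a : K) : density (even_val a) = Re (top_coef a).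
Proof. by []. Qed.

(** [sigma] only sees real parts, whereas positivity in R[i] also requires a zero imaginary part;
    the latter holds because products of Hermitian forms are real. *)
Lemma Gamma_gamma_cone (chi : local_forms A) m i x (g : 'M[C]_n) (a : K) :
  (m <= n)%N -> Gamma w m chi -> img i x -> hermitian_mx g -> posdef_mx g ->
  w i x = even_val (hform g) -> chi i x = even_val a -> hermitian_form a ->
  gamma_cone g m a.
Proof.
move=> mn Gm xi hg pg wg ca ha; split=> // j jm.
have top0 : 0 < top_coef (hform g ^+ n) by exact: posdef_top_gt0.
have [->|j0] := posnP j; first by rewrite expr0 mul1r subn0.
have jn : (j <= n)%N by exact: leq_trans jm mn.
have := Gm j; rewrite j0 jm => /(_ isT i x xi).
rewrite /sigma ca wg -!even_valX -even_valM !density_even.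
rewrite pmulr_rgt0 ?ltr0n ?bin_gt0//.
have d0 : 0 < Re (top_coef (hform g ^+ n)) by move: top0; rewrite ltcE => /andP[].
rewrite pmulr_lgt0 ?invr_gt0// => pos.
have ra : real_form a by have [h hh ->] := ha; exact: hermitian_real_form.
rewrite ltcE /= pos andbT; apply/eqP/real_form_top.
by apply: real_formM; apply: real_formX => //; exact: hermitian_real_form.
Qed.

Definition chart_fun (i : chart A) : E -> R := u \o chart_inv i.

Lemma chart_fun_C2 i : Ck (img i) 2 (chart_fun i).
Proof. exact: u_C2. Qed.

Lemma chi_scale (t : R) i x : img i x ->
  chi_ chi0 (fun q => t * u q) i x =
  chi0 i x + escale t%:C (form11 (hessian_mx (chart_fun i) x)).
Proof.
move=> xi; congr (_ + _).
rewrite (ddbar_fun (f := fun y => t * chart_fun i y) (Ck_scale t (chart_fun_C2 i)) xi).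
by rewrite hessian_scale -!even_val_hform hformZ even_val_constM.
Qed.

Definition mixed_density a b c (i : chart A) (x : E) : R :=
  expR (- p * u (chart_inv i x)) *
  density (wedge (wedge (form11 (grad_mx (chart_fun i) x))
     (wedge (wedge_exp (chi0 i x) a) (wedge_exp (form11 (hessian_mx (chart_fun i) x)) b)))
     (wedge_exp (w i x) c)).

Lemma mixed_density_continuous a b c : locally_continuous (mixed_density a b c).
Proof.
move=> i x xi; have cf := chart_fun_C2 i.
have [[_ w_smooth _] _ _] := w_kahler; have [_ chi0_smooth _] := chi0_form.
apply: continuousM.
  apply: (@continuous_comp _ _ _ (fun y => - p * u (chart_inv i y)) expR).
    apply: continuousM; first exact: cst_continuous.
    exact: (Ck_continuous cf xi).
  exact: continuous_expR.
apply: fcont_density; apply: fcontM.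
  apply: fcontM; first exact: (fcont_grad cf xi).
  apply: fcontM; apply: fcont_exp; last exact: (fcont_hessian cf xi).
  exact: (smooth_form_fcont (chi0_smooth i) xi).
by apply: fcont_exp; exact: (smooth_form_fcont (w_smooth i) xi).
Qed.

Arguments mixed_density_continuous a b c i x _ : clear implicits.

(** The exponent of w fills up the degree: 1 for V, then a and b, with total n. *)
Definition mixed_integral a b := density_int (mixed_density a b (n - (a + b).+1)).

Lemma pointwise_data i x : img i x -> exists (g h0 : 'M[C]_n),
  let om : K := hform g in let e0 : K := hform h0 in
  let h : K := hform (hessian_mx (chart_fun i) x) in
  [/\ hermitian_mx g /\ posdef_mx g, w i x = even_val om, chi0 i x = even_val e0 &
      [/\ gamma_cone g k.-1 e0, gamma_cone g k.-1 (e0 + h) &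
        gamma_cone g k.-1 (e0 - io tau%:C * om)]].
Proof.
move=> xi; have [g [hg pg wg]] := kahler_matrix xi.
have [_ _ chi0_real] := chi0_form.
have [h0 hh0 ch0] := real11_hermitian_form (chi0_real i x xi).
have kn : (k.-1 <= n)%N.
  by case/andP: k_bounds => _; apply: leq_trans; exact: leq_pred.
have hh := hessian_hermitian (@img_open _ _ _ A i) (chart_fun_C2 i) xi.
exists g, h0; split=> //; split.
- by apply: (Gamma_gamma_cone kn chi0_Gamma xi hg pg wg ch0); exists h0.
- apply: (Gamma_gamma_cone kn chi_u_Gamma xi hg pg wg).
    by rewrite /chi_ (ddbar_fun (chart_fun_C2 i) xi) ch0 -even_val_hform.
  by apply: hermitian_formD; [exists h0|exists (hessian_mx (chart_fun i) x)].
- apply: (Gamma_gamma_cone kn chi0_lower xi hg pg wg).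
    by rewrite ch0 wg even_valD even_valN even_val_constM.
  rewrite -mulNr -rmorphN -rmorphN; apply: hermitian_formD; first by exists h0.
  by apply: hermitian_formZ; exists g.
Qed.

Lemma mixed_density_even i x (g h0 : 'M[C]_n) a b c :
  w i x = even_val (hform g) -> chi0 i x = even_val (hform h0) ->
  mixed_density a b c i x = expR (- p * u (chart_inv i x)) *
  Re (top_coef (hform (grad_mx (chart_fun i) x) *
    (hform h0 ^+ a * hform (hessian_mx (chart_fun i) x) ^+ b) * hform g ^+ c)).
Proof.
move=> wg ch; rewrite /mixed_density wg ch -!even_val_hform -!even_valX -!even_valM.
by [].
Qed.

Lemma weighted_gradient_even i x (g h0 : 'M[C]_n) (t : R) N c : img i x ->
  w i x = even_val (hform g) -> chi0 i x = even_val (hform h0) ->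
  density (weighted_gradient_form p u (chi_ chi0 (fun q => t * u q)) N w c i x) =
  expR (- p * u (chart_inv i x)) *
  Re (top_coef (hform (grad_mx (chart_fun i) x) *
    (hform h0 + io t%:C * hform (hessian_mx (chart_fun i) x)) ^+ N * hform g ^+ c)).
Proof.
move=> xi wg ch; rewrite /weighted_gradient_form (chi_scale _ xi) wg ch.
have -> : fun_form u i = form_of_fun (chart_fun i) by [].
have E e i' (a b c' : extalg R (n * 2)) : escale (e * i') (wedge (wedge a b) c') =
    escale e (wedge (wedge (escale i' a) b) c') by rewrite !wedgeZl escaleA.
rewrite E gradient_form -even_val_hform -even_val_hform.
rewrite -even_val_constM -even_valD -!even_valX -!even_valM -even_val_constM density_even.
by rewrite top_coef_linear.2 complex_ReM /= mul0r subr0.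
Qed.

Lemma Re_sum I (r : seq I) (F : I -> C) : Re (\sum_(i <- r) F i) = \sum_(i <- r) Re (F i).
Proof.
by apply: (big_morph (fun z : C => Re z) (@ReD R)).
Qed.

Lemma Re_realM (t : R) (z : C) : Re (t%:C * z) = t * Re z.
Proof. by rewrite complex_ReM /= mul0r subr0. Qed.

Lemma Re_Mn (z : C) m : Re (z *+ m) = Re z *+ m.
Proof. by elim: m => [|m IH]; rewrite ?mulr0n// !mulrSr ReD IH. Qed.

Lemma top_binomial (v e0 h om : K) (t : R) N :
  Re (top_coef (v * (e0 + io t%:C * h) ^+ N * om)) =
  \sum_(r < N.+1) t ^+ r * Re (top_coef (v * (e0 ^+ (N - r) * h ^+ r) * om)) *+ 'C(N, r).
Proof.
rewrite exprDn mulr_sumr mulr_suml (linear_form_sum _ _ _ top_coef_linear) Re_sum.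
apply: eq_bigr => r _; rewrite mulrnAr mulrnAl (linear_formMn _ _ top_coef_linear).
rewrite Re_Mn; congr (_ *+ _).
have -> : v * (e0 ^+ (N - r) * (io t%:C * h) ^+ r) * om =
   io (t ^+ r)%:C * (v * (e0 ^+ (N - r) * h ^+ r) * om).
  by rewrite exprMn !rmorphXn; ring.
by rewrite top_coef_linear.2 Re_realM.
Qed.

Lemma top_binomial_sub (v e0 h om : K) (t s : R) N c :
  Re (top_coef (v * ((e0 + io t%:C * h) ^+ N * (e0 - io s%:C * om)) * om ^+ c)) =
  \sum_(r < N.+1) t ^+ r * (Re (top_coef (v * (e0 ^+ (N.+1 - r) * h ^+ r) * om ^+ c)) -
    s * Re (top_coef (v * (e0 ^+ (N - r) * h ^+ r) * om ^+ c.+1))) *+ 'C(N, r).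
Proof.
set P := (e0 + _) ^+ N.
have -> : v * (P * (e0 - io s%:C * om)) * om ^+ c =
    v * P * (e0 * om ^+ c) + io (- s)%:C * (v * P * om ^+ c.+1).
  by rewrite exprS !rmorphN; ring.
rewrite top_coef_linear.1 ReD top_coef_linear.2 Re_realM.
have B := top_binomial v e0 h _ t N.
rewrite (B (e0 * om ^+ c)) (B (om ^+ c.+1)) mulr_sumr -big_split; apply: eq_bigr => r _ /=.
have -> : v * (e0 ^+ (N - r) * h ^+ r) * (e0 * om ^+ c) =
    v * (e0 ^+ (N.+1 - r) * h ^+ r) * om ^+ c.
  by rewrite subSn ?exprS; [ring|rewrite -ltnS].
by rewrite [- s * _]mulrnAr -mulrnDl; congr (_ *+ _); ring.
Qed.

(** Binomial expansion of X_t^N and linearity over M. The right side is a polynomial in t, which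
    settles integrability and differentiability in t. *)
Lemma weighted_integral (t : R) N :
  manifold_int (weighted_gradient_form p u (chi_ chi0 (fun q => t * u q)) N w (n - N.+1)) =
  (moment_poly mixed_integral N).[t].
Proof.
rewrite manifold_intE horner_poly.
rewrite (eq_density_int (psi := fun i x => \sum_(r < N.+1)
    (t ^+ r *+ 'C(N, r)) * mixed_density (N - r) r (n - N.+1) i x)); last first.
  move=> i x xi; have [g [h0 [_ wg ch _]]] := pointwise_data xi.
  rewrite (weighted_gradient_even _ _ _ xi wg ch) top_binomial mulr_sumr.
  apply: eq_bigr => r _; rewrite (mixed_density_even _ _ _ wg ch).
  by rewrite -mulr_natr -[_ *+ 'C(_, _) in RHS]mulr_natr; ring.
rewrite (density_int_sum M_compact); last first.
  by move=> r; apply: locally_continuousZ; exact: mixed_density_continuous.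
apply: eq_bigr => r _; rewrite (density_intZ M_compact); last exact: mixed_density_continuous.
rewrite /mixed_integral subnK; last by rewrite -ltnS.
by rewrite mulrnAl mulrC mulrnAl.
Qed.

(** X_t = (1 - t) chi0 + t chi_u, and 1 - t stays positive up to t = 1/2. *)
Lemma interpolated_cone i x (g h0 : 'M[C]_n) (t : R) : 0 <= t <= 2^-1 ->
  hermitian_mx g -> posdef_mx g ->
  gamma_cone g k.-1 (hform h0) ->
  gamma_cone g k.-1 (hform h0 + hform (hessian_mx (chart_fun i) x)) ->
  gamma_cone g k.-1 (hform h0 + io t%:C * hform (hessian_mx (chart_fun i) x)).
Proof.
move=> /andP[t0 t1] hg pg c0 c1.
have kn : (k.-1 <= n)%N.
  by case/andP: k_bounds => _; apply: leq_trans; exact: leq_pred.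
have s0 : 0 < 1 - t by move: t1; lra.
have := gamma_cone_comb hg pg kn s0 t0 c0 c1.
by congr gamma_cone; rewrite rmorphB rmorph1 rmorphB rmorph1; ring.
Qed.

Lemma moment_step N : (N.+2 < k)%N ->
  tau * (N.+1%:R * poly_int (moment_poly mixed_integral N)) <=
  N.+2%:R * poly_int (moment_poly mixed_integral N.+1).
Proof.
move=> Nk; have kn : (k.-1 < n)%N.
  by case/andP: k_bounds => k2 kn; rewrite prednK// ltnW.
have Nk1 : (N.+2 <= k.-1)%N by rewrite -ltnS prednK// (leq_trans _ Nk).
have Nn : (N.+2 < n)%N by exact: leq_ltn_trans kn.
have expR_ge0 (s : R) : 0 <= expR s by exact: expR_ge0.
have Re_ge0 (z : C) : 0 <= z -> 0 <= Re z by rewrite lecE => /andP[].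
apply: moment_poly_ineq => [t t01|].
  rewrite horner_poly.
  (* The terms of degree r in t of V X_t^N B w^(n-N-2); trading chi0 for w raises the exponent of w
     to n-N-1. *)
  pose F (r : 'I_N.+1) (i : chart A) (x : E) : R := (t ^+ r *+ 'C(N, r)) *
    (mixed_density (N.+1 - r) r (n - N.+2) i x -
     tau * mixed_density (N - r) r (n - N.+1) i x).
  have cF r : locally_continuous (F r).
    apply: locally_continuousZ.
    have := locally_continuousD (mixed_density_continuous (N.+1 - r) r (n - N.+2))
      (locally_continuousZ (c := - tau) (mixed_density_continuous (N - r) r (n - N.+1))).
    by congr locally_continuous; apply/funext => i; apply/funext => x; rewrite mulNr.
  rewrite (_ : \sum_(_ < _) _ = \sum_(r < N.+1) density_int (F r)).
    rewrite -(density_int_sum M_compact _ cF).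
    apply: density_int_ge0 => i x xi.
    have [g [h0 [[hg pg] wg ch [c0 c1 cB]]]] := pointwise_data xi.
    have cX := interpolated_cone t01 hg pg c0 c1.
    have := gamma_cone_ge0 hg pg (grad_mx_hermitian (chart_fun i) x)
      (grad_mx_ge0 (chart_fun i) x) kn Nk1 cX cB.
    move=> /Re_ge0 pos.
    have -> : \sum_(r < N.+1) F r i x = expR (- p * u (chart_inv i x)) *
       Re (top_coef (hform (grad_mx (chart_fun i) x) *
         ((hform h0 + io t%:C * hform (hessian_mx (chart_fun i) x)) ^+ N *
          (hform h0 - io tau%:C * hform g)) * hform g ^+ (n - N.+2))).
      rewrite top_binomial_sub mulr_sumr; apply: eq_bigr => r _.
      rewrite /F !(mixed_density_even _ _ _ wg ch).
      have -> : (n - N.+1 = (n - N.+2).+1)%N by rewrite subnSK// ltnW.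
      by rewrite mulrnAl [RHS]mulrnAr; congr (_ *+ _); ring.
    by rewrite mulr_ge0.
  apply: eq_bigr => r _; rewrite /F (density_intZ M_compact); last first.
    have := locally_continuousD (mixed_density_continuous (N.+1 - r) r (n - N.+2))
      (locally_continuousZ (c := - tau) (mixed_density_continuous (N - r) r (n - N.+1))).
    by congr locally_continuous; apply/funext => i; apply/funext => x; rewrite mulNr.
  have -> : density_int (fun i x => mixed_density (N.+1 - r) r (n - N.+2) i x -
     tau * mixed_density (N - r) r (n - N.+1) i x) =
     mixed_integral (N.+1 - r) r - tau * mixed_integral (N - r) r.
    have rN : (r <= N)%N by rewrite -ltnS.
    rewrite /mixed_integral !subnK// ?leqW//.
    rewrite -mulNr -(density_intZ M_compact); last exact: mixed_density_continuous.
    rewrite -(density_intD M_compact).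
    - by apply: eq_density_int => i x _; rewrite mulNr.
    - exact: mixed_density_continuous.
    - by apply: locally_continuousZ; exact: mixed_density_continuous.
  by rewrite mulrnAl mulrC mulrnAl.
(* The boundary term, with X_t at t = 1/2 in the place of B as well. *)
rewrite -weighted_integral manifold_intE; apply: density_int_ge0 => i x xi.
have [g [h0 [[hg pg] wg ch [c0 c1 cB]]]] := pointwise_data xi.
rewrite (weighted_gradient_even _ _ _ xi wg ch) mulr_ge0//; apply: Re_ge0.
have t01 : 0 <= (2^-1 : R) <= 2^-1 by rewrite lexx invr_ge0 ler0n.
have cX := interpolated_cone t01 hg pg c0 c1.
have := gamma_cone_ge0 hg pg (grad_mx_hermitian (chart_fun i) x)
  (grad_mx_ge0 (chart_fun i) x) kn Nk1 cX cX.
by rewrite exprSr.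
Qed.

End Main.

Unset Implicit Arguments.

Theorem lemma3p2 (R : realType) (n : nat) (M : topologicalType)
    (A : holAtlas R n M) (w chi0 : local_forms A) (k : nat) (tau : R)
    (u : M -> R)
    (n_ge2 : (2 <= n)%N)
    (M_hausdorff : hausdorff_space M) (M_compact : compact [set: M])
    (w_kahler : kahler_form w)
    (k_bounds : (2 <= k <= n)%N)
    (chi0_form : smooth_real11_form chi0)
    (chi0_Gamma : Gamma w k.-1 chi0)
    (tau_gt0 : 0 < tau)
    (chi0_lower :
       Gamma w k.-1 (fun i x => chi0 i x - escale (tau%:C)%C (w i x)))
    (chi0_upper :
       Gamma w k.-1 (fun i x => w i x - escale (tau%:C)%C (chi0 i x)))
    (u_C2 : funCk A 2 u)
    (chi_u_Gamma : Gamma w k.-1 (chi_ chi0 u)) :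
  forall (l : nat) (p : R), (2 <= l < k)%N -> 0 < p ->
    tau ^+ (k - l) *
      (\int[lebesgue_measure]_(t in `[0%R, 2^-1]%classic)
         manifold_int
           (weighted_gradient_form p u (chi_ chi0 (fun q => t * u q)) (l - 2)
              w (n - l + 1)))
    <= (k.-1%:R / l.-1%:R) *
      (\int[lebesgue_measure]_(t in `[0%R, 2^-1]%classic)
         manifold_int
           (weighted_gradient_form p u (chi_ chi0 (fun q => t * u q)) (k - 2)
              w (n - k + 1))).
Proof.
move=> l p /andP[l2 lk] _; have [k2 kn] := andP k_bounds.
pose c := mixed_integral w chi0 u p.
have intE N : (2 <= N <= n)%N ->
    \int[lebesgue_measure]_(t in `[0%R, 2^-1]%classic) manifold_int
      (weighted_gradient_form p u (chi_ chi0 (fun q => t * u q)) (N - 2) w (n - N + 1)) =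
    poly_int (moment_poly c (N - 2)).
  move=> /andP[N2 Nn]; apply: eq_Rintegral => t _.
  (* Subtraction is truncated, so both bounds on N are used. *)
  have -> : (n - N + 1 = n - (N - 2).+1)%N.
    by case: (N) N2 Nn => [|[|N']] // _ Nn; rewrite subn2 /= addn1 subnSK.
  exact: (weighted_integral p M_compact w_kahler k_bounds chi0_form chi0_Gamma chi0_lower u_C2 chi_u_Gamma).
rewrite !intE ?l2 ?k2 ?(leq_trans (ltnW lk))//.
(* With the factor N + 1 absorbed, one step is just tau a_N <= a_(N+1) and can be iterated. At N = l
   - 2 and N = k - 2 the factors are l - 1 and k - 1, the constants of the theorem. *)
pose a N := N.+1%:R * poly_int (moment_poly c N).
have step N : (N.+2 < k)%N -> tau * a N <= a N.+1.
  exact: (moment_step p M_compact w_kahler k_bounds chi0_form chi0_Gamma chi0_lower u_C2 chi_u_Gamma).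
have chain d : (l - 2 + d < k.-1)%N -> tau ^+ d * a (l - 2)%N <= a (l - 2 + d)%N.
  elim: d => [|d IH] dk; first by rewrite expr0 mul1r addn0.
  rewrite exprS -mulrA addnS; apply: le_trans (step _ _).
    by rewrite ler_pM2l// IH// (leq_trans _ dk)// addnS.
  by move: dk; rewrite addnS -ltnS prednK// (leq_trans _ k2).
have := chain (k - l)%N.
have El : (l - 2).+1 = l.-1 by case: l l2 {lk chain} => [|[|l]] //= _; rewrite subn2.
have Ek : (k - 2).+1 = k.-1 by case: (k) k2 => [|[|k']] //= _; rewrite subn2.
have -> : (l - 2 + (k - l) = k - 2)%N by rewrite addnBAC// subnKC// ltnW.
rewrite /a El Ek -Ek ltnS leqnn => /(_ isT).
have l0 : 0 < l.-1%:R :> R by rewrite ltr0n -El.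
by rewrite mulrCA -ler_pdivlMl// mulrA [_^-1 * _]mulrC.
Qed.
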